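(* Put $a=dt/t$ and $b=dt/(1-t)$. Then, for all non-negative integers $m$ and $n$ with $m\ge 2n$, \[ \sum_{\vec s\in C_{2n+1}(m-2n)}Z(\vec s)=\int_0^1 T_{m,n}=\frac{Z(m)}{2n+1}\binom{m}{2n}=\frac{2\pi^{2m}}{(2m+2)!}\binom{m+1}{2n+1}. \]
   Context: For positive integers $s_1,\dots,s_k$ with $s_1>1$, the multiple zeta value is $\zeta(s_1,\dots,s_k):=\sum_{n_1>n_2>\cdots>n_k>0}\prod_{j=1}^k n_j^{-s_j}$; for the empty argument string its value is $1$. The notation $\{2\}^{r}$ in an argument string means $r$ consecutive arguments equal to $2$ (none if $r=0$). For non-negative integers $k$ and $r$, $C_r(k)$ denotes the set of ordered $r$-tuples of non-negative integers with sum $k$. For a non-negative integer $n$ and a vector $\vec s=(m_0,m_1,\dots,m_{2n})$ of non-negative integers, define \[ Z(\vec s):=\zeta(\{2\}^{m_0},3,\{2\}^{m_1},1,\{2\}^{m_2},3,\{2\}^{m_3},1,\dots,3,\{2\}^{m_{2n-1}},1,\{2\}^{m_{2n}}), \] i.e. $m_j$ consecutive twos are inserted after the $j$th element of the string $3,1,3,1,\dots,3,1$ ($n$ repetitions of $3,1$) for $j=0,1,\dots,2n$. For $n=0$ and a single non-negative integer $m$, $Z(m)=\zeta(\{2\}^m)$. Words: let $\mathbf{Q}\langle a,b\rangle$ be the non-commutative polynomial ring spanned by words in $a,b$, with $1$ the empty word. The shuffle product $\sqcup\!\sqcup$ is the bilinear product on it determined on words by $1\sqcup\!\sqcup w=w\sqcup\!\sqcup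 1=w$ and $cu\sqcup\!\sqcup dv=c(u\sqcup\!\sqcup dv)+d(cu\sqcup\!\sqcup v)$ for letters $c,d$ and words $u,v$. For integers $m\ge n\ge 0$, $S_{m,n}$ is the set of words occurring in $(ab)^n\sqcup\!\sqcup(ab)^{m-n}$ in which the (contiguous) subword $a^2$ appears exactly $n$ times, and $T_{m,n}$ is the sum of the $\binom{m}{2n}$ distinct words in $S_{m,n}$. Iterated integrals: for a word $\alpha_1\alpha_2\cdots\alpha_r$ of differential $1$-forms $\alpha_j=f_j(t_j)\,dt_j$, $\int_0^1\alpha_1\cdots\alpha_r:=\int_{1>t_1>t_2>\cdots>t_r>0}\prod_{j=1}^r f_j(t_j)\,dt_j$, with the integral of the empty word equal to $1$; this is extended linearly to linear combinations of words. *)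

(* Defs.v *)
From HB Require Import structures.
From mathcomp Require Import all_boot all_order all_algebra finmap.
From mathcomp Require Import all_classical all_reals all_analysis.
(* The notations of monalg declare a precedence level incompatible with the one
   of MathComp-Analysis, hence the import without notations. *)
From mathcomp Require Import -(notations) monalg.

Set Implicit Arguments.
Unset Strict Implicit.
Unset Printing Implicit Defensive.

Import Order.TTheory GRing.Theory Num.Theory.
Import numFieldNormedType.Exports.

Local Open Scope classical_set_scope.
Local Open Scope ring_scope.

(** * Multiple zeta values *)

(* Valued in the extended reals: the sum of a series of nonnegative terms, so
   that an equation with a finite value includes the convergence. *)
Definition mzv (R : realType) (s : seq nat) : \bar R :=
  \esum_(n in [set n : (size s).-tuple nat |
                 sorted gtn n /\ all (fun x => 0 < x)%N n])
    (\prod_(j < size s) (tnth n j)%:R ^- tnth (in_tuple s) j)%:E.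

(* [Zarg n [m_0; ...; m_2n]] is {2}^m_0 followed, for each i < n, by the block
   3, {2}^m_(2i+1), 1, {2}^m_(2i+2). *)
Definition Zarg (n : nat) (m : (2 * n).+1.-tuple nat) : seq nat :=
  nseq (nth 0%N m 0) 2%N ++
  flatten [seq (3%N :: nseq (nth 0%N m (2 * i).+1) 2%N) ++
               (1%N :: nseq (nth 0%N m (2 * i).+2) 2%N) | i <- iota 0 n].

Definition Zval (R : realType) (n : nat) (m : (2 * n).+1.-tuple nat) : \bar R :=
  mzv R (Zarg m).

Definition compositions (r k : nat) : set (r.-tuple nat) :=
  [set s | (\sum_(i < r) tnth s i)%N = k].
Arguments compositions : clear implicits.

(** * Words, shuffles and the polynomials T_{m,n} *)

Inductive letter := la | lb.

Definition bool_of_letter (c : letter) : bool := if c is la then true else false.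
Definition letter_of_bool (x : bool) : letter := if x then la else lb.
Fact bool_of_letterK : cancel bool_of_letter letter_of_bool.
Proof. by case. Qed.

HB.instance Definition _ := Countable.copy letter (can_type bool_of_letterK).

Notation word := (fmonom letter).

(* The free algebra Q<a,b>, i.e. the monoid algebra of the free monoid. *)
Notation ncpoly := (malg word rat).

(* Locked, because unification otherwise computes with finite supports. *)
HB.lock Definition poly_of_word (w : word) : ncpoly := mkmalgU w 1.
Canonical poly_of_word_unlock := Unlockable poly_of_word.unlock.
Definition Xl (c : letter) : ncpoly := poly_of_word (FMonom [:: c]).

Fixpoint shuffle_word (u : seq letter) : seq letter -> ncpoly :=
  match u with
  | [::] => fun v => poly_of_word (FMonom v)
  | c :: u' =>
      fix shuffle_u (v : seq letter) : ncpoly :=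
        match v with
        | [::] => poly_of_word (FMonom (c :: u'))
        | d :: v' => Xl c * shuffle_word u' (d :: v') + Xl d * shuffle_u v'
        end
  end.

Definition shuffle (p q : ncpoly) : ncpoly :=
  \sum_(u <- msupp p) \sum_(v <- msupp q)
    (mcoeff u p * mcoeff v q) *: shuffle_word u v.

Definition count_aa (w : seq letter) : nat :=
  count (pred1 (la, la)) (zip w (behead w)).

Definition S_words (m n : nat) : {fset word} :=
  [fset w in msupp (shuffle ((Xl la * Xl lb) ^+ n) ((Xl la * Xl lb) ^+ (m - n)))
     | count_aa w == n]%fset.

Definition T_poly (m n : nat) : ncpoly := \sum_(w <- S_words m n) poly_of_word w.

(** * Iterated integrals *)

(* The Lebesgue integral over R^r, as successive integrals over R, the first
   coordinate outermost.  For nonnegative measurable F this is, by Tonelli, the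
   integral against the product measure. *)
Fixpoint integral_Rn (R : realType) (r : nat) (F : seq R -> \bar R) : \bar R :=
  if r is r'.+1 then
    (\int[@lebesgue_measure R]_t integral_Rn r' (fun ts => F (t :: ts)))%E
  else F [::].

(* A 1-form f(t) dt is represented by its density f.  The sortedness condition
   reads 1 > t_1 > ... > t_r > 0. *)
Definition iterated_integral (R : realType) (fs : seq (R -> R)) : \bar R :=
  integral_Rn (size fs) (fun t =>
    (if sorted >%R (1 :: rcons t 0)
     then \prod_(j < size fs) (tnth (in_tuple fs) j) (nth 0 t j)
     else 0)%:E).

(* Linear extension to polynomials, the letter c standing for the 1-form of
   density [form c]. *)
Definition integral_ncpoly (R : realType) (form : letter -> R -> R)
    (p : ncpoly) : \bar R :=
  (\sum_(w <- msupp p)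
     (ratr (mcoeff w p) : R)%:E * iterated_integral (map form w))%E.

Definition form01 (R : realType) (c : letter) : R -> R :=
  match c with
  | la => fun t => t^-1
  | lb => fun t => (1 - t)^-1
  end.

(* Main.v *)
(** Two letters at a time, a word of the shuffle of (ab)^n and (ab)^(m-n), read
with a = +1 and b = -1, is a path that starts and ends at 0 and stays at, or
jumps between, the heights 0 and 2. Hence the shuffle product is the sum over j
of 4^j C(m-2j, n-j) T_{m,j}, and T_{m,n} is the sum of the words of the Z(s).
Since the iterated integral of a word has a power series expansion whose
coefficients multiply like shuffles, integrating this expansion for all n
yields a triangular system for the integrals of the T_{m,j}, whose right-hand
sides are products of two values zeta({2}^n) = pi^(2n)/(2n+1)!. That value
follows from Cauchy's comparison of 1/x^2 with cot^2 x at the points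
x = k pi/(2N+1). The system is solved by the claimed values because counting
the words in the shuffle of b(ab)^n and b(ab)^(m-n) in two ways gives
C(2m+2, 2n+1) = sum_j 2 4^j C(m-2j, n-j) C(m+1, 2j+1). *)
Require Import Defs.
From mathcomp Require Import all_boot all_order all_algebra finmap.
From mathcomp Require Import all_classical all_reals all_analysis.
From mathcomp Require Import -(notations) monalg.
From mathcomp Require Import measurable_realfun.
From mathcomp Require Import ring lra zify.

Set Implicit Arguments.
Unset Strict Implicit.
Unset Printing Implicit Defensive.

Import Order.TTheory GRing.Theory Num.Theory.
Import numFieldNormedType.Exports.

Local Open Scope classical_set_scope.
Local Open Scope ring_scope.

(** * Elementary symmetric functions of the 1/k^2 *)

Section CoefProd.
Context {R : numDomainType}.
Implicit Types (p q : {poly R}) (N : nat).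

Lemma coefM_ler p q p' q' :
  (forall n, 0 <= p`_n <= p'`_n) -> (forall n, 0 <= q`_n <= q'`_n) ->
  forall n, 0 <= (p * q)`_n <= (p' * q')`_n.
Proof.
move=> hp hq n; rewrite !coefM; apply/andP; split.
  apply: sumr_ge0 => i _.
  by have /andP[? _] := hp i; have /andP[? _] := hq (n - i)%N; exact: mulr_ge0.
apply: ler_sum => i _.
by have /andP[? ?] := hp i; have /andP[? ?] := hq (n - i)%N; exact: ler_pM.
Qed.

Lemma coef_prod_ler N (p q : nat -> {poly R}) :
  (forall k n, (k < N)%N -> 0 <= (p k)`_n <= (q k)`_n) ->
  forall n, 0 <= (\prod_(k < N) p k)`_n <= (\prod_(k < N) q k)`_n.
Proof.
elim: N => [|N IH] h n.
  by rewrite !big_ord0 coef1; case: (n == _) => /=; rewrite ?ler01 ?lexx.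
rewrite !big_ord_recr /=; apply: coefM_ler => i; last exact: h.
by apply: IH => k j kN; apply: h; rewrite ltnS ltnW.
Qed.

Lemma coef_1DZX (x : R) n : (1 + x *: 'X)`_n = (n == 0)%:R + x * (n == 1)%:R.
Proof. by rewrite coefD coef1 coefZ coefX. Qed.

End CoefProd.

(** The elementary symmetric polynomial of degree n in x_0, ..., x_(N-1), read off from its
    generating polynomial. *)
Definition esymR {R : nzRingType} (N : nat) (x : nat -> R) (n : nat) : R :=
  (\prod_(k < N) (1 + x k *: 'X))`_n.

Section Esym.
Context {R : numFieldType}.
Implicit Types (N n : nat) (x y : nat -> R).

Lemma esymR0 x n : esymR 0 x n = (n == 0)%:R.
Proof. by rewrite /esymR big_ord0 coef1. Qed.

Lemma esymRS0 N x : esymR N x 0 = 1.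
Proof.
elim: N => [|N IH]; first by rewrite esymR0.
rewrite /esymR big_ord_recr /= coef0M -/(esymR N x 0) IH coef_1DZX.
by rewrite mulr0 addr0 mulr1.
Qed.

Lemma esymRS N x n :
  esymR N.+1 x n.+1 = esymR N x n.+1 + x N * esymR N x n.
Proof.
rewrite /esymR big_ord_recr /= mulrDr mulr1 coefD -scalerAr coefZ coefMX /=.
by [].
Qed.

Lemma esymR_ler N x y :
  (forall k, (k < N)%N -> 0 <= x k <= y k) ->
  forall n, 0 <= esymR N x n <= esymR N y n.
Proof.
move=> h; apply: (@coef_prod_ler _ N (fun k => 1 + x k *: 'X)
  (fun k => 1 + y k *: 'X)) => k n kN.
rewrite !coef_1DZX; have /andP[x0 xy] := h k kN.
by rewrite addr_ge0 ?mulr_ge0 ?ler0n //= lerD2l ler_wpM2r ?ler0n.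
Qed.

(** Coefficientwise, 1 + (x + e)X lies below (1 + xX)(1 + eX), and the factors 1 + eX multiply to (1
    + eX)^N. *)
Lemma esymR_addr_le N x (e : R) n :
  0 <= e -> (forall k, (k < N)%N -> 0 <= x k) ->
  esymR N (fun k => x k + e) n <=
    \sum_(j < n.+1) esymR N x j * (e ^+ (n - j) *+ 'C(N, n - j)).
Proof.
move=> e0 x0.
suff /andP[_] : 0 <= esymR N (fun k => x k + e) n <=
  (\prod_(k < N) ((1 + x k *: 'X) * (1 + e *: 'X)))`_n.
  move=> /le_trans; apply; rewrite big_split /= prodr_const card_ord coefM.
  apply: ler_sum => j _; rewrite /esymR.
  rewrite (_ : ((1 + e *: ('X : {poly R})) ^+ N)`_(n - j) =
               e ^+ (n - j) *+ 'C(N, n - j)) //.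
  rewrite exprDn coef_sum; under eq_bigr do
    rewrite expr1n mul1r coefMn exprZn coefZ coefXn -mulrnAl.
  set i := (n - j)%N; have [iN|iN] := ltnP i N.+1.
    rewrite (bigD1 (Ordinal iN)) //= eqxx mulr1 big1 ?addr0 // => k.
    by rewrite -val_eqE /= eq_sym => /negbTE ->; rewrite mulr0.
  rewrite bin_small // mulr0n big1 // => k _.
  by rewrite gtn_eqF ?mulr0 // (leq_trans (ltn_ord k)).
apply: (@coef_prod_ler _ N (fun k => 1 + (x k + e) *: 'X)
  (fun k => (1 + x k *: 'X) * (1 + e *: 'X))) => k {}n kN.
have xk := x0 k kN.
have -> : (1 + x k *: 'X) * (1 + e *: 'X) =
    1 + (x k + e) *: 'X + (x k * e) *: 'X^2 :> {poly R}.
  rewrite -!mul_polyC polyCM polyCD; ring.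
rewrite coef_1DZX coefD coef_1DZX coefZ coefXn.
rewrite addr_ge0 ?ler0n ?mulr_ge0 ?addr_ge0 //=.
by rewrite lerDl mulr_ge0 ?mulr_ge0 ?ler0n.
Qed.

End Esym.

(** * Cauchy's squeeze and the limit pi^(2n)/(2n+1)! *)

Section Tangent.
Context {R : realType}.
Implicit Types (x : R) (N n : nat).

Lemma sin_le_id x : 0 <= x -> sin x <= x.
Proof.
move=> x0; have [|c _] := @MVT_segment _ sin cos 0 x x0.
- by apply/continuous_subspaceT => y; exact: continuous_sin.
by rewrite sin0 !subr0 => ->; rewrite ler_piMl // cos_le1.
Qed.

Lemma id_le_tan x : 0 <= x < pi / 2 -> x <= tan x.
Proof.
move=> /andP[x0 xpi].
have cos0 y : y \in `[0, x] -> 0 < cos y.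
  move=> /itvP y0x; rewrite cos_gt0_pihalf // (le_lt_trans _ xpi) ?y0x // andbT.
  by rewrite (@lt_le_trans _ _ 0) ?y0x // oppr_lt0 divr_gt0 ?pi_gt0.
have [y y0x||c c0x] := @MVT_segment _ tan (fun x => (cos x) ^-2) 0 x x0.
- by apply: is_derive_tan; rewrite gt_eqF // cos0 // subset_itv_oo_cc.
- apply/continuous_in_subspaceT => y /[!(@mem_setE R)] y0x.
  by apply: continuous_tan; rewrite gt_eqF // cos0.
rewrite tan0 !subr0 => ->; rewrite ler_peMl //.
by rewrite invf_ge1 ?exprn_gt0 ?cos0 // exprn_ile1 ?cos_le1 ?ltW ?cos0.
Qed.

(** From sin x <= x <= tan x, since cot^2 x + 1 = 1/sin^2 x. *)
Lemma cot2_bounds x : 0 < x < pi / 2 ->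
  (tan x) ^- 2 <= x ^- 2 <= (tan x) ^- 2 + 1.
Proof.
move=> /andP[x0 xpi].
have xtan : x <= tan x by rewrite id_le_tan ?ltW.
have tan0 : 0 < tan x by exact: lt_le_trans xtan.
rewrite lef_pV2 ?posrE ?exprn_gt0 //.
rewrite ler_pXn2r ?nnegrE ?(ltW x0) ?(ltW tan0) // xtan /=.
have sinp : 0 < sin x by rewrite sin_gt0_pihalf ?x0.
have -> : (tan x) ^- 2 + 1 = (sin x) ^- 2.
  rewrite /tan -[RHS]mul1r -[X in _ = X * _](cos2Dsin2 x); field.
  by rewrite !gt_eqF // cos_gt0_pihalf // xpi
    (lt_trans _ x0) // oppr_lt0 divr_gt0 ?pi_gt0.
rewrite lef_pV2 ?posrE ?exprn_gt0 //.
by rewrite ler_pXn2r ?nnegrE ?sin_le_id ?(ltW sinp) ?(ltW x0).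
Qed.

Let S N : {poly R} := (1 + 'X) ^+ N.

(** De Moivre's formula without complex numbers: the real and imaginary parts of (1 + i tan x)^N
    come from the even and odd parts of (1 + X)^N at (i tan x)^2 = - tan^2 x. *)
Lemma cos_sin_even_odd_poly N x : cos x != 0 ->
  cos (N%:R * x) = cos x ^+ N * (even_poly (S N)).[- tan x ^+ 2] /\
  sin (N%:R * x) = cos x ^+ N * tan x * (odd_poly (S N)).[- tan x ^+ 2].
Proof.
move=> cx; elim: N => [|N [IHc IHs]].
  rewrite mul0r cos0 sin0 /S !expr0 -(polyC1 R) even_polyC odd_polyC.
  by rewrite hornerC horner0 mulr0 mulr1.
rewrite mulrSr mulrDl mul1r cosD sinD IHc IHs /S [(1 + 'X) ^+ N.+1]exprSr mulrDr mulr1.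
rewrite even_polyD odd_polyD even_polyMX odd_polyMX !hornerD hornerM hornerX.
have sx : sin x = cos x * tan x by rewrite /tan mulrC divfK.
by rewrite sx [cos x ^+ N.+1]exprSr; split; ring.
Qed.

Lemma XDone_exp N : S N = ('X - (-1)%:P) ^+ N.
Proof. by rewrite /S polyCN polyC1 opprK addrC. Qed.

(* The roots of the odd part of (1 + X)^(2N+1) are the -tan^2(k pi/(2N+1)). *)
Lemma prod_cot2 N :
  \prod_(k < N) (1 + (tan (k.+1%:R * (pi / N.*2.+1%:R))) ^- 2 *: 'X) =
  N.*2.+1%:R^-1 *: odd_poly (S N.*2.+1) :> {poly R}.
Proof.
set d := pi / _; set t := fun k : nat => tan (k.+1%:R * d).
have d0 : 0 < d by rewrite divr_gt0 ?pi_gt0.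
have th k : (k < N)%N -> 0 < k.+1%:R * d < pi / 2.
  move=> kN; rewrite mulr_gt0 //= /d mulrCA ltr_pM2l ?pi_gt0 //.
  by rewrite ltr_pdivrMr // mulrC ltr_pdivlMr // -natrM ltr_nat; lia.
have t0 k : (k < N)%N -> 0 < t k.
  by move=> kN; have /andP[h0 hpi] := th k kN; rewrite (lt_le_trans h0) ?id_le_tan ?ltW.
set Q := odd_poly _.
pose rs := [seq - t k ^+ 2 | k <- iota 0 N].
have szQ : size Q = N.+1.
  by rewrite /Q size_odd_poly_eq XDone_exp size_exp_XsubC /= ?odd_double // doubleK.
have Qdef : Q = lead_coef Q *: \prod_(z <- rs) ('X - z%:P).
  apply: all_roots_prod_XsubC; first by rewrite szQ size_map size_iota.
    apply/allP => z /mapP[k]; rewrite mem_iota add0n => /andP[_ kN] ->.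
    have /andP[h0 hpi] := th k kN.
    have cpos : cos (k.+1%:R * d) != 0.
      rewrite gt_eqF // cos_gt0_pihalf // hpi (lt_trans _ h0) //.
      by rewrite oppr_lt0 divr_gt0 ?pi_gt0.
    (* As sin((k+1) pi) = 0 and neither cos nor tan vanishes at the point, the polynomial factor
       must. *)
    have [_] := cos_sin_even_odd_poly N.*2.+1 cpos.
    have -> : N.*2.+1%:R * (k.+1%:R * d) = pi *+ k.+1.
      by rewrite /d mulrCA [_%:R * (pi / _)]mulrC divfK ?pnatr_eq0 // mulr_natl.
    rewrite -{1}(add0r (pi *+ _)) (alternatingn (@sinDpi R)) sin0 mulr0 => /esym/eqP.
    rewrite mulf_eq0 mulf_eq0 (gt_eqF (t0 k kN)) expf_eq0 (negbTE cpos) andbF.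
    by [].
  rewrite uniq_rootsE map_inj_in_uniq ?iota_uniq // => i j.
  rewrite !mem_iota !add0n => /andP[_ iN] /andP[_ jN] /oppr_inj /eqP.
  rewrite eqrXn2 ?ltW ?t0 // => /eqP.
  have inI k : (k < N)%N -> k.+1%:R * d \in `](- (pi / 2)), (pi / 2)[.
    move=> /th/andP[h0 hpi]; rewrite in_itv /= hpi (lt_trans _ h0) //.
    by rewrite oppr_lt0 divr_gt0 ?pi_gt0.
  move=> /tan_inj -/(_ (inI _ iN) (inI _ jN)) /(mulIf _) /eqP.
  by rewrite gt_eqF // eqr_nat eqSS => /(_ isT)/eqP.
have lcQ : lead_coef Q = 1.
  rewrite lead_coefE szQ coef_odd_poly XDone_exp.
  have /(monic_exp N.*2.+1)/monicP := monicXsubC (- 1 : R).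
  by rewrite lead_coefE size_exp_XsubC.
have Qprod : Q = \prod_(k < N) ('X + (t k ^+ 2)%:P).
  rewrite Qdef lcQ scale1r big_map -(big_mkord xpredT (fun k => 'X + (t k ^+ 2)%:P)).
  by rewrite /index_iota subn0; apply: eq_bigr => k _; rewrite polyCN opprK.
(* Comparing constant coefficients gives the factor that turns each X + t_k^2 into 1 + t_k^-2 X. *)
have Q0 : N.*2.+1%:R = \prod_(k < N) t k ^+ 2.
  have -> : N.*2.+1%:R = Q`_0 :> R.
    rewrite coef_odd_poly /S exprDn coef_sum.
    under eq_bigr do rewrite expr1n mul1r coefMn coefXn.
    rewrite double0 (bigD1 (inord 1)) //= inordK // eqxx bin1 big1 ?addr0 // => i.
    by rewrite -val_eqE /= inordK // eq_sym => /negbTE ->; rewrite mul0rn.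
  rewrite -horner_coef0 Qprod horner_prod; apply: eq_bigr => k _.
  by rewrite hornerD hornerX hornerC add0r.
rewrite Q0 Qprod -prodfV -mul_polyC rmorph_prod -big_split /=; apply: eq_bigr => k _.
have := t0 k (ltn_ord k); rewrite -/d -/(t k) => tk.
rewrite mulrDr addrC -!mul_polyC -polyCM mulVf ?polyC1 //.
by rewrite expf_neq0 // gt_eqF.
Qed.

Lemma esymR_cot2 N n :
  esymR N (fun k => (tan (k.+1%:R * (pi / N.*2.+1%:R))) ^- 2) n =
  'C(N.*2.+1, n.*2.+1)%:R / N.*2.+1%:R :> R.
Proof.
rewrite /esymR prod_cot2 coefZ coef_odd_poly mulrC; congr (_ / _).
rewrite /S exprDn coef_sum.
under eq_bigr do rewrite expr1n mul1r coefMn coefXn.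
have [nN|nN] := ltnP n.*2.+1 N.*2.+2.
  rewrite (bigD1 (Ordinal nN)) //= eqxx big1 ?addr0 // => i.
  by rewrite -val_eqE /= eq_sym => /negbTE ->; rewrite mul0rn.
rewrite bin_small // big1 // => i _.
by rewrite gtn_eqF ?mul0rn // (leq_trans (ltn_ord i)).
Qed.

Lemma esymRZ N (c : R) (x : nat -> R) n :
  esymR N (fun k => c * x k) n = c ^+ n * esymR N x n.
Proof.
elim: N n => [|N IH] [|n]; rewrite ?esymRS0 ?expr0 ?mulr1 //.
  by rewrite !esymR0 mulr0.
by rewrite !esymRS !IH exprS; ring.
Qed.

(* Cauchy's squeeze: 1/tan^2 <= 1/x^2 <= 1/tan^2 + 1 at the points k d. *)
Lemma esymR_invn2_bounds N n (d := pi / N.*2.+1%:R : R) :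
  d ^+ n.*2 * ('C(N.*2.+1, n.*2.+1)%:R / N.*2.+1%:R) <=
  esymR N (fun k => k.+1%:R ^- 2) n <=
  \sum_(j < n.+1) d ^+ j.*2 * ('C(N.*2.+1, j.*2.+1)%:R / N.*2.+1%:R) *
    ((d ^+ 2) ^+ (n - j) *+ 'C(N, n - j)).
Proof.
pose y k := d ^+ 2 * (tan (k.+1%:R * d)) ^- 2.
have d0 : 0 < d by rewrite divr_gt0 ?pi_gt0.
have ey j : esymR N y j = d ^+ j.*2 * ('C(N.*2.+1, j.*2.+1)%:R / N.*2.+1%:R).
  by rewrite /y esymRZ esymR_cot2 -exprM mul2n.
have y0 k : 0 <= y k by rewrite mulr_ge0 ?invr_ge0 ?sqr_ge0.
have yx k : (k < N)%N -> y k <= k.+1%:R ^- 2 <= y k + d ^+ 2.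
  move=> kN; have -> : k.+1%:R ^- 2 = d ^+ 2 * (k.+1%:R * d) ^- 2 :> R.
    have : k.+1%:R != 0 :> R by rewrite pnatr_eq0.
    by move: k.+1%:R => K K0; field; rewrite K0 gt_eqF.
  rewrite /y -[X in _ + X]mulr1 -mulrDr !ler_pM2l ?exprn_gt0 //.
  apply: cot2_bounds; rewrite mulr_gt0 //= /d mulrCA ltr_pM2l ?pi_gt0 //.
  by rewrite ltr_pdivrMr // mulrC ltr_pdivlMr // -natrM ltr_nat; lia.
rewrite -ey; apply/andP; split.
  have h k : (k < N)%N -> 0 <= y k <= k.+1%:R ^- 2.
    by move=> /yx/andP[-> _]; rewrite y0.
  by have /andP[] := esymR_ler h n.
under eq_bigr do rewrite -ey.
apply: le_trans (esymR_addr_le _ (sqr_ge0 d) (fun k _ => y0 k)).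
have h k : (k < N)%N -> 0 <= (k.+1%:R ^- 2 : R) <= y k + d ^+ 2.
  by move=> /yx/andP[_ ->]; rewrite invr_ge0 exprn_ge0.
by have /andP[] := esymR_ler h n.
Qed.

Lemma cvg_bin_ratio k :
  'C(N.*2.+1, k)%:R / N.*2.+1%:R ^+ k @[N --> \oo] --> (k`!%:R^-1 : R).
Proof.
elim: k => [|k IH].
  by under eq_cvg do rewrite bin0 expr0 divr1; rewrite fact0 invr1; exact: cvg_cst.
have -> : (fun N => 'C(N.*2.+1, k.+1)%:R / N.*2.+1%:R ^+ k.+1 : R) =
    (fun N => 'C(N.*2.+1, k)%:R / N.*2.+1%:R ^+ k *
      ((N.*2.+1 - k)%:R / N.*2.+1%:R) / k.+1%:R).
  apply/funext => N; have := mul_bin_left N.*2.+1 k.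
  move=> /(congr1 (fun n => n%:R : R)); rewrite !natrM => h.
  have M0 : N.*2.+1%:R != 0 :> R by rewrite pnatr_eq0.
  have k0 : k.+1%:R != 0 :> R by rewrite pnatr_eq0.
  move: h M0 k0; rewrite exprS.
  move: (N.*2.+1%:R : R) (k.+1%:R : R) => M K h M0 K0.
  by apply: (mulfI K0); rewrite [LHS]mulrA h; field; rewrite M0 K0 expf_neq0.
rewrite factS natrM mulrC invfM -[X in X / _]mulr1.
apply: cvgMr_tmp; apply: cvgM; first exact: IH.
(* For M = 2N+1 >= N+1, the ratio (M-k)/M lies between 1 - k/(N+1) and 1, also where the subtraction
   truncates. *)
apply: (@squeeze_cvgr _ _ _ _ (fun N => 1 - k%:R * harmonic N) (cst 1)).
- near=> N; rewrite /= ler_pdivrMr // mul1r ler_nat leq_subr andbT.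
  rewrite ler_pdivlMr // mulrBl mul1r.
  apply: (@le_trans _ _ (N.*2.+1%:R - k%:R)).
    rewrite lerD2l lerN2 -mulrA ler_peMr // mulrC ler_pdivlMr // mul1r ler_nat.
    by rewrite -addnn -addSn leq_addr.
  have [kN|kN] := leqP k N.*2.+1; first by rewrite natrB.
  by rewrite (le_trans _ (ler0n _ _)) // subr_le0 ler_nat ltnW.
- rewrite -[X in _ --> X]subr0; apply: cvgB; first exact: cvg_cst.
  by rewrite -[X in _ --> X](mulr0 k%:R); apply: cvgMl_tmp; exact: cvg_harmonic.
- exact: cvg_cst.
Unshelve. all: end_near. Qed.

(** C(N, i) grows at most like N^i, against a decay like N^(-2i). This removes all terms but j = n
    from the upper bound of the squeeze. *)
Lemma cvg_bin_small i :
  ((pi / N.*2.+1%:R) ^+ 2) ^+ i *+ 'C(N, i) @[N --> \oo] --> ((i == 0)%:R : R).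
Proof.
elim: i => [|i IH] /=.
  by under eq_cvg do rewrite expr0 bin0; exact: cvg_cst.
have -> : (fun N => ((pi / N.*2.+1%:R) ^+ 2) ^+ i.+1 *+ 'C(N, i.+1) : R) =
   (fun N => (((pi / N.*2.+1%:R) ^+ 2) ^+ i *+ 'C(N, i)) *
      ((pi / N.*2.+1%:R) ^+ 2 * (N - i)%:R) / i.+1%:R).
  apply/funext => N; have := mul_bin_left N i.
  move=> /(congr1 (fun n => n%:R : R)); rewrite !natrM => h.
  have i0 : i.+1%:R != 0 :> R by rewrite pnatr_eq0.
  move: h i0; move: (i.+1%:R : R) => I h I0; apply: (mulfI I0).
  rewrite -[_ *+ 'C(N, i.+1)]mulr_natr mulrCA h -[_ *+ 'C(N, i)]mulr_natr exprS.
  by move: ((pi / _) ^+ 2) => d2; field.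
rewrite -[X in _ --> X](mul0r (i.+1%:R^-1)); apply: cvgMr_tmp.
rewrite -[X in _ --> X](mulr0 ((i == 0)%:R)); apply: cvgM; first exact: IH.
apply: (@squeeze_cvgr _ _ _ _ (cst 0) (fun N => pi ^+ 2 * harmonic N)).
- near=> N; rewrite /= mulr_ge0 ?sqr_ge0 //= expr_div_n -mulrA.
  rewrite ler_pM2l ?exprn_gt0 ?pi_gt0 //.
  rewrite mulrC ler_pdivrMr ?exprn_gt0 // mulrC ler_pdivlMr // -natrM -natrX ler_nat.
  by rewrite expnS expn1; apply: leq_mul; rewrite -addnn -?addSn; lia.
- exact: cvg_cst.
- by rewrite -[X in _ --> X](mulr0 (pi ^+ 2)); apply: cvgMl_tmp; exact: cvg_harmonic.
Unshelve. all: end_near. Qed.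

Lemma cvg_sum_ord k (f : nat -> nat -> R) (l : nat -> R) :
  (forall j, f j N @[N --> \oo] --> l j) ->
  \sum_(j < k) f j N @[N --> \oo] --> \sum_(j < k) l j.
Proof.
move=> h; elim: k => [|k IH].
  by rewrite big_ord0; under eq_cvg do rewrite big_ord0; exact: cvg_cst.
by rewrite big_ord_recr; under eq_cvg do rewrite big_ord_recr /=; exact: cvgD.
Qed.

(** The lower bound and the term j = n of the upper bound are the same sequence, whose limit comes
    from C(2N+1, 2n+1)/(2N+1)^(2n+1) tending to 1/(2n+1)!. *)
Lemma cvg_esymR_invn2 n :
  esymR N (fun k => k.+1%:R ^- 2) n @[N --> \oo] -->
  (pi ^+ n.*2 / (n.*2.+1)`!%:R : R).
Proof.
have main j : (pi / N.*2.+1%:R) ^+ j.*2 * ('C(N.*2.+1, j.*2.+1)%:R / N.*2.+1%:R)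
    @[N --> \oo] --> (pi ^+ j.*2 / (j.*2.+1)`!%:R : R).
  under eq_cvg => N.
    have -> : (pi / N.*2.+1%:R) ^+ j.*2 * ('C(N.*2.+1, j.*2.+1)%:R / N.*2.+1%:R) =
      pi ^+ j.*2 * ('C(N.*2.+1, j.*2.+1)%:R / N.*2.+1%:R ^+ j.*2.+1) :> R.
      have : N.*2.+1%:R != 0 :> R by rewrite pnatr_eq0.
      rewrite expr_div_n exprS; move: (N.*2.+1%:R : R) => M M0.
      by field; rewrite M0 expf_neq0.
    over.
  by apply: cvgMl_tmp; exact: cvg_bin_ratio.
apply: (squeeze_cvgr _ (main n)); first by near=> N; exact: esymR_invn2_bounds.
have -> : pi ^+ n.*2 / (n.*2.+1)`!%:R =
    \sum_(j < n.+1) pi ^+ j.*2 / (j.*2.+1)`!%:R * ((n - j)%N == 0)%:R :> R.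
  rewrite big_ord_recr /= subnn mulr1 big1 ?add0r // => j _.
  by rewrite subn_eq0 leqNgt ltn_ord mulr0.
apply: (@cvg_sum_ord n.+1 (fun j N => (pi / N.*2.+1%:R) ^+ j.*2 *
  ('C(N.*2.+1, j.*2.+1)%:R / N.*2.+1%:R) *
  (((pi / N.*2.+1%:R) ^+ 2) ^+ (n - j) *+ 'C(N, n - j)))
  (fun j => pi ^+ j.*2 / (j.*2.+1)`!%:R * ((n - j)%N == 0)%:R)) => j.
by apply: cvgM; [exact: main | exact: cvg_bin_small].
Unshelve. all: end_near. Qed.
End Tangent.

(** * Shuffles of powers of ab *)

(** Unlike [shuffle_word], this lists the words themselves, repeated according to multiplicity. *)
Fixpoint shuf (u : seq letter) : seq letter -> seq (seq letter) :=
  match u with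
  | [::] => fun v => [:: v]
  | c :: u' =>
      fix shuf_u (v : seq letter) : seq (seq letter) :=
        match v with
        | [::] => [:: c :: u']
        | d :: v' =>
            map (cons c) (shuf u' (d :: v')) ++ map (cons d) (shuf_u v')
        end
  end.

Lemma shuf_cons c u d v : shuf (c :: u) (d :: v) =
  map (cons c) (shuf u (d :: v)) ++ map (cons d) (shuf (c :: u) v).
Proof. by []. Qed.

Lemma shufs0 u : shuf u [::] = [:: u].
Proof. by case: u. Qed.

Fixpoint abn (n : nat) : seq letter :=
  if n is n'.+1 then [:: la, lb & abn n'] else [::].

(* A word of the shuffle of (ab)^n and (ab)^p, read with a = +1 and b = -1, is a
   path in {0, 1, 2}; two letters at a time it stays at an even height or jumps
   between 0 and 2.  [paths m k] lists the words of m such pairs of letters with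
   k jumps that end at height 0, so that the parity of k gives the starting
   height. *)
Definition stay (k : nat) : seq letter :=
  if odd k then [:: lb; la] else [:: la; lb].
Definition jump (k : nat) : seq letter :=
  if odd k then [:: lb; lb] else [:: la; la].

Fixpoint paths (m k : nat) : seq (seq letter) :=
  match m with
  | 0 => if k == 0 then [:: [::]] else [::]
  | m'.+1 => map (cat (stay k)) (paths m' k) ++
             (if k is k'.+1 then map (cat (jump k)) (paths m' k') else [::])
  end.

Lemma paths_small m k : (m < k)%N -> paths m k = [::].
Proof.
elim: m k => [|m IH] [|k] //= mk; rewrite !IH //.
by apply: leq_trans mk.
Qed.

Lemma paths0 m : paths m 0 = [:: abn m].
Proof. by elim: m => //= m ->. Qed.

(* The multiplicity, up to the factor 4^j, of the words with 2j jumps in the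
   shuffle of (ab)^n and (ab)^p. *)
Fixpoint shufmul (n p j : nat) : nat :=
  match j, n, p with
  | 0, _, _ => 'C(n + p, n)
  | j'.+1, n'.+1, p'.+1 => shufmul n' p' j'
  | _, _, _ => 0
  end.

Lemma shufmul0n p j : shufmul 0 p j = (j == 0).
Proof. by case: j => // ; rewrite /= bin0. Qed.

Lemma shufmuln0 n j : shufmul n 0 j = (j == 0).
Proof. by case: j => [|j]; case: n => //= n; rewrite ?addn0 ?binn. Qed.

(** The recursion of [shufmul] preserves n - j and n + p - 2j. *)
Lemma shufmulE n p j : (j <= n)%N -> (j <= p)%N ->
  shufmul n p j = 'C(n + p - 2 * j, n - j).
Proof.
elim: j n p => [|j IH] [|n] [|p] //=; rewrite ?muln0 ?subn0 ?bin0 // !ltnS => jn jp.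
by rewrite IH // subSS; congr 'C(_, _); lia.
Qed.

(** Pascal's rule. The bound excludes n = p = j, where the left side is 1 and the right side 0. *)
Lemma shufmul_rec n p j : (2 * j < n + p)%N -> shufmul n p j =
  ((if n is n'.+1 then shufmul n' p j else 0) +
   (if p is p'.+1 then shufmul n p' j else 0))%N.
Proof.
elim: j n p => [|j IH] [|n] [|p]; rewrite ?shufmul0n ?shufmuln0 ?addn0 //.
- have E n' p' : shufmul n' p' 0 = 'C(n' + p', n') by case: n' p' => [|?] [|?].
  by move=> _; rewrite !E addSn binS addnC addSnnS.
- move=> h; rewrite [LHS]/= IH; last by lia.
  by case: n h => [|n] h; case: p h.
Qed.

Section ShuffleSum.
Context {V : nmodType}.
Implicit Types (g : seq letter -> V).

(** An arbitrary [g] lets one expansion serve for polynomials, for power series coefficients and for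
    counting. *)
Definition pathsum m k g : V := \sum_(w <- paths m k) g w.

Lemma pathsumS0 m g : pathsum m.+1 0 g = pathsum m 0 (g \o cat [:: la; lb]).
Proof. by rewrite /pathsum /= cats0 big_map. Qed.

Lemma pathsumSS m k g : pathsum m.+1 k.+1 g =
  pathsum m k.+1 (g \o cat (stay k.+1)) + pathsum m k (g \o cat (jump k.+1)).
Proof. by rewrite /pathsum /= big_cat !big_map. Qed.

Definition shufsum u v g : V := \sum_(w <- shuf u v) g w.

Lemma shufsum_cons c u d v g : shufsum (c :: u) (d :: v) g =
  shufsum u (d :: v) (g \o cons c) + shufsum (c :: u) v (g \o cons d).
Proof. by rewrite /shufsum shuf_cons big_cat !big_map. Qed.

Lemma shufsum0s v g : shufsum [::] v g = g v.
Proof. by rewrite /shufsum big_seq1. Qed.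

Lemma shufsums0 u g : shufsum u [::] g = g u.
Proof. by rewrite /shufsum shufs0 big_seq1. Qed.

Lemma shufsum_abn0n p K g : (0 < K)%N ->
  g (abn p) = \sum_(j < K) pathsum p (2 * j) g *+ (4 ^ j * (j == 0 :> nat)).
Proof.
case: K => // K _; rewrite big_ord_recl big1 ?addr0.
  by rewrite /pathsum paths0 big_seq1.
by move=> j _; rewrite muln0.
Qed.

(** A predicate, since it is proved together with [bshuf_expansion] by induction. [K] can be any
    bound above n because the multiplicity vanishes for j > n; so recursive calls share one range of
    summation. *)
Definition shuf_expansion n p := forall K g, (n < K)%N ->
  shufsum (abn n) (abn p) g =
  \sum_(j < K) pathsum (n + p) (2 * j) g *+ (4 ^ j * shufmul n p j).

(** The situation once an a has been taken from each word: the path is at height 2 and has an odd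
    number of jumps left. *)
Definition bshuf_expansion n p := forall K g, (n < K)%N ->
  shufsum (lb :: abn n) (lb :: abn p) g =
  \sum_(j < K) pathsum (n + p).+1 (2 * j).+1 g *+ (2 * 4 ^ j * shufmul n p j).

(** The first two letters are ba, both from the same word, or bb, one from each word in either
    order. The latter case gives the factor 2. *)
Lemma bshuf_expansion_rec n p : shuf_expansion n p ->
  (forall n', n = n'.+1 -> bshuf_expansion n' p) ->
  (forall p', p = p'.+1 -> bshuf_expansion n p') ->
  bshuf_expansion n p.
Proof.
move=> A Bn Bp K g nK; pose g1 := g \o cat [:: lb; la].
have -> : shufsum (lb :: abn n) (lb :: abn p) g =
  (if n is n'.+1 then shufsum (lb :: abn n') (lb :: abn p) g1 else 0) +
  (if p is p'.+1 then shufsum (lb :: abn n) (lb :: abn p') g1 else 0) +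
  shufsum (abn n) (abn p) (g \o cat [:: lb; lb]) *+ 2.
  rewrite shufsum_cons.
  have -> : shufsum (abn n) (lb :: abn p) (g \o cons lb) =
    (if n is n'.+1 then shufsum (lb :: abn n') (lb :: abn p) g1 else 0)
    + shufsum (abn n) (abn p) (g \o cat [:: lb; lb]).
    by case: n {A Bn Bp nK} => [|n] /=; rewrite ?shufsum0s ?add0r // shufsum_cons.
  have -> : shufsum (lb :: abn n) (abn p) (g \o cons lb) =
    (if p is p'.+1 then shufsum (lb :: abn n) (lb :: abn p') g1 else 0)
    + shufsum (abn n) (abn p) (g \o cat [:: lb; lb]).
    by case: p {A Bn Bp} => [|p] /=; rewrite ?shufsums0 ?add0r // shufsum_cons addrC.
  by rewrite addrACA -mulr2n.
rewrite (A K) //.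
have -> : (if n is n'.+1 then shufsum (lb :: abn n') (lb :: abn p) g1 else 0) =
  \sum_(j < K) pathsum (n + p) (2 * j).+1 g1 *+
    (2 * 4 ^ j * (if n is n'.+1 then shufmul n' p j else 0)).
  case: n A Bn Bp nK => [|n] A Bn Bp nK; last by rewrite (Bn n erefl K) ?(ltnW nK).
  by rewrite big1 // => j _; rewrite muln0.
have -> : (if p is p'.+1 then shufsum (lb :: abn n) (lb :: abn p') g1 else 0) =
  \sum_(j < K) pathsum (n + p) (2 * j).+1 g1 *+
    (2 * 4 ^ j * (if p is p'.+1 then shufmul n p' j else 0)).
  case: p A Bn Bp => [|p] A Bn Bp; last by rewrite (Bp p erefl K) // addnS.
  by rewrite big1 // => j _; rewrite muln0.
rewrite -sumrMnl -!big_split /=; apply: eq_bigr => j _.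
rewrite pathsumSS /stay /jump /= mul2n odd_double /= mulrnDl -!mul2n; congr (_ + _).
  rewrite -mulrnDr -mulnDr.
  (* Beyond the range of Pascal's rule, n + p steps are too few for 2j+1 jumps, so the path sum is
     empty. *)
  have [h|h] := ltnP (2 * j) (n + p); first by rewrite [in RHS]shufmul_rec.
  by rewrite /pathsum paths_small ?big_nil ?mul0rn // ltnS.
by rewrite -mulrnA; congr (_ *+ _); rewrite mulnC mulnA.
Qed.

(** The first two letters are ab, both from the same word, or aa, one from each word in either
    order. The two orders and the factor 2 of [bshuf_expansion] combine to 4. *)
Lemma shuf_expansion_rec n p :
  (forall n', n = n'.+1 -> shuf_expansion n' p) ->
  (forall p', p = p'.+1 -> shuf_expansion n p') ->
  (forall n' p', n = n'.+1 -> p = p'.+1 -> bshuf_expansion n' p') ->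
  shuf_expansion n p.
Proof.
case: n p => [|n] [|p] An Ap B K g nK.
- rewrite shufsum0s (@shufsum_abn0n 0 K) //.
  by apply: eq_bigr => j _; rewrite shufmul0n.
- rewrite shufsum0s (@shufsum_abn0n p.+1 K) //.
  by apply: eq_bigr => j _; rewrite shufmul0n.
- rewrite shufsums0 (@shufsum_abn0n n.+1 K) ?(leq_trans _ nK) //.
  by apply: eq_bigr => j _; rewrite addn0 shufmuln0.
have -> : shufsum (abn n.+1) (abn p.+1) g =
  shufsum (abn n) (abn p.+1) (g \o cat [:: la; lb]) +
  shufsum (abn n.+1) (abn p) (g \o cat [:: la; lb]) +
  shufsum (lb :: abn n) (lb :: abn p) (g \o cat [:: la; la]) *+ 2.
  rewrite [abn n.+1]/= [abn p.+1]/= shufsum_cons.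
  rewrite (shufsum_cons lb (abn n) la) (shufsum_cons la (lb :: abn n) lb).
  by rewrite [X in _ + X]addrC addrACA -mulr2n.
rewrite (An n erefl K) ?(ltnW nK) // (Ap p erefl K) //.
case: K nK => // K nK; rewrite (B n p erefl erefl K) //.
rewrite -big_split /=.
(* The term j = 0 has no jump; in the others, using up the first of 2(j+1) jumps leaves 2j+1. *)
have -> : \sum_(j < K.+1)
    pathsum (n.+1 + p.+1) (2 * j) g *+ (4 ^ j * shufmul n.+1 p.+1 j) =
  \sum_(j < K.+1) pathsum (n + p).+1 (2 * j) (g \o cat [:: la; lb]) *+
    (4 ^ j * shufmul n.+1 p.+1 j) +
  \sum_(j < K) pathsum (n + p).+1 (2 * j).+1 (g \o cat [:: la; la]) *+
    (4 ^ j.+1 * shufmul n p j).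
  rewrite big_ord_recl [in RHS]big_ord_recl -addrA; congr (_ + _).
    by rewrite addSn addnS pathsumS0.
  rewrite -big_split; apply: eq_bigr => j _.
  rewrite lift0 addSn addnS mulnS add2n pathsumSS /stay /jump.
  by rewrite /= mul2n odd_double /= mulrnDl.
congr (_ + _).
  apply: eq_bigr => j _; rewrite addSn addnS -mulrnDr -mulnDr.
  have [h|h] := ltnP (2 * j) (n.+1 + p.+1); first by rewrite [in RHS]shufmul_rec.
  rewrite /pathsum paths_small ?big_nil ?mul0rn //; lia.
rewrite -sumrMnl; apply: eq_bigr => j _; rewrite -mulrnA; congr (_ *+ _).
by rewrite expnS; lia.
Qed.

Lemma shuf_expansions n p : shuf_expansion n p /\ bshuf_expansion n p.
Proof.
have [s] := ubnP (n + p); elim: s n p => // s IH n p nps.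
have A : shuf_expansion n p.
  apply: shuf_expansion_rec => [n' e|p' e|n' p' e e'].
  - by have [] : shuf_expansion n' p /\ bshuf_expansion n' p by apply: IH; lia.
  - by have [] : shuf_expansion n p' /\ bshuf_expansion n p' by apply: IH; lia.
  - by have [] : shuf_expansion n' p' /\ bshuf_expansion n' p' by apply: IH; lia.
split=> //; apply: bshuf_expansion_rec => // [n' e|p' e].
- by have [] : shuf_expansion n' p /\ bshuf_expansion n' p by apply: IH; lia.
- by have [] : shuf_expansion n p' /\ bshuf_expansion n p' by apply: IH; lia.
Qed.

Lemma shuf_expansionP n p : shuf_expansion n p.
Proof. by case: (shuf_expansions n p). Qed.

End ShuffleSum.

(** * Paths as words and as compositions *)

Lemma paths_odd_head m k w : odd k -> w \in paths m k -> exists w', w = lb :: w'.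
Proof.
case: m k => [|m] [|k] //= ko; rewrite mem_cat => /orP[] /mapP[u _ ->].
  by rewrite /stay /= ko; eexists.
by rewrite /jump /= ko; eexists.
Qed.

(** Each aa is a jump from 0 to 2. None straddles two blocks: a block ending in a leaves the path at
    height 2, where the next block starts with b. *)
Lemma paths_count_aa m k w : w \in paths m k -> count_aa w = k./2.
Proof.
have cat_ab u : count_aa (la :: lb :: u) = count_aa u by case: u => //; case.
have cat_bb u : count_aa (lb :: lb :: u) = count_aa u by case: u => //; case.
elim: m k w => [|m IH] [|k] w //=; rewrite ?inE ?cats0.
- by move=> /eqP ->.
- by move=> /mapP[u /IH + ->]; rewrite cat_ab.
rewrite mem_cat => /orP[] /mapP[u um ->].
  rewrite /stay /=; have := IH _ _ um; case: ifPn => [ko|_] /= <-; last exact: cat_ab.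
  by have [u' ->] := paths_odd_head (ko : odd k.+1) um.
rewrite /jump /= uphalf_half; case: ifPn => [/negbTE ko|/negbNE ke].
  by rewrite /= cat_bb (IH _ _ um) ko.
by have [u' uE] := paths_odd_head ke um; rewrite -(IH _ _ um) uE ke.
Qed.

Lemma paths_uniq m k : uniq (paths m k).
Proof.
have cinj (u : seq letter) : injective (cat u).
  by move=> x y /eqP; rewrite eqseq_cat // eqxx => /eqP.
elim: m k => [|m IH] [|k] //; rewrite [paths _ _]/=.
  by rewrite cats0 map_inj_uniq // => x y [].
rewrite cat_uniq !(map_inj_uniq (cinj _)) !IH andbT /=.
apply/hasPn => _ /mapP[u _ ->]; apply/mapP => -[v _].
by rewrite /stay /jump; case: ifP.
Qed.

(** A block that arrives at height 0 ends in b. The default [lb] admits the empty word; in this form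
    the condition later ensures convergence at 0. *)
Lemma paths_last m k w : w \in paths m k -> last lb w = lb.
Proof.
suff h c : w \in paths m k -> (k == 0) ==> (c == lb) -> last c w = lb.
  by move=> /h; apply; rewrite eqxx implybT.
elim: m k w c => [|m IH] [|k] w c /=; rewrite ?inE ?cats0.
- by move=> /eqP -> /eqP.
- by [].
- by move=> /mapP[u /IH + ->] _ /=; apply; rewrite eqxx implybT.
rewrite mem_cat => /orP[] /mapP[u /IH + ->] _; rewrite /stay /jump /=.
  by case: ifP => _ /=; apply.
by case: ifP => /= ko; apply; case: k ko.
Qed.

(** Follows the recursion of [paths]: a stay increments the first part and a jump opens a new part
    0, so the parts count the stays between jumps. *)
Fixpoint comps (m k : nat) : seq (seq nat) :=
  match m with
  | 0 => if k == 0 then [:: [:: 0%N]] else [::]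
  | m'.+1 => map (fun s => (head 0%N s).+1 :: behead s) (comps m' k) ++
             (if k is k'.+1 then map (cons 0%N) (comps m' k') else [::])
  end.

Fixpoint comp_word (s : seq nat) : seq letter :=
  if s is i :: s' then
    iter i (cat (stay (size s')))
      (if s' is [::] then [::] else jump (size s') ++ comp_word s')
  else [::].

Lemma mem_comps m k s : (s \in comps m k) = (size s == k.+1) && (sumn s + k == m)%N.
Proof.
have incrP k' (r : seq (seq nat)) i s' :
    (forall t, t \in r -> size t = k'.+1) ->
    (i :: s' \in map (fun t => (head 0%N t).+1 :: behead t) r) =
    (0 < i)%N && (i.-1 :: s' \in r).
  move=> sz; apply/mapP/andP => [[t tr [-> ->]]|[i0 h]].
    by split => //=; move: (sz _ tr); case: t tr.
  by exists (i.-1 :: s') => //=; rewrite prednK.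
elim: m k s => [|m IH] k s.
  case: k => [|k]; case: s => [|i [|j s]] //=;
    by rewrite ?inE ?addn0 ?addnS ?andbF ?eqseq_cons ?andbT ?andbF.
rewrite [comps _ _]/= mem_cat; case: s => [|i s].
  by apply/orP => -[/mapP[]//|]; case: k => // k /mapP[].
rewrite (incrP k) => [|t]; last by rewrite IH => /andP[/eqP].
rewrite IH /= eqSS.
have -> : (i :: s \in
     if k is k'.+1 then map (cons 0%N) (comps m k') else [::]) =
    [&& i == 0, size s == k & (sumn s + k == m.+1)%N]%N.
  case: k => [|k]; first by case: s => [|? ?]; rewrite ?andbF // addn0 /= andbF.
  apply/mapP/and3P => [[t + [-> ->]]|[/eqP -> sz sm]].
    by rewrite IH addnS eqSS => /andP[].
  by exists s => //; rewrite IH sz; move: sm; rewrite addnS.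
case: i => [|i]; rewrite /= ?add0n ?addSn ?eqSS //.
by rewrite orbF.
Qed.

Lemma comp_word_comps m k : map comp_word (comps m k) = paths m k.
Proof.
have sz m' k' s : s \in comps m' k' -> size s = k'.+1.
  by rewrite mem_comps => /andP[/eqP].
elim: m k => [|m IH] k; first by case: k.
rewrite /= map_cat -IH -map_comp -[in RHS]map_comp; congr (_ ++ _).
  apply/eq_in_map => s /sz; case: s => //= i s [->] //.
case: k => // k; rewrite -IH -map_comp -[in RHS]map_comp.
by apply/eq_in_map => s /sz; case: s => //= i s [->].
Qed.

Lemma comps_uniq m k : uniq (comps m k).
Proof. by apply: (@map_uniq _ _ comp_word); rewrite comp_word_comps paths_uniq. Qed.

Definition Zargs (n : nat) (s : seq nat) : seq nat :=
  nseq (nth 0%N s 0) 2%N ++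
  flatten [seq (3%N :: nseq (nth 0%N s (2 * i).+1) 2%N) ++
               (1%N :: nseq (nth 0%N s (2 * i).+2) 2%N) | i <- iota 0 n].

Definition mzv_word (s : seq nat) : seq letter :=
  flatten [seq rcons (nseq i.-1 la) lb | i <- s].

(** With i encoded as a^(i-1) b, the arguments 3, {2}^i, 1 spell aab (ab)^i b, which regroups as aa
    (ba)^i bb: a jump up, i stays at height 2 and a jump down. *)
Lemma Zargs_word n s : size s = (2 * n).+1 -> mzv_word (Zargs n s) = comp_word s.
Proof.
have mzv_cat s1 s2 : mzv_word (s1 ++ s2) = mzv_word s1 ++ mzv_word s2.
  by rewrite /mzv_word map_cat flatten_cat.
have twos i u : mzv_word (nseq i 2%N) ++ u = iter i (cat [:: la; lb]) u.
  by elim: i => //= i <-.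
elim: n s => [|n IH] [|i0 s] //=.
  by case: s => // _; rewrite /Zargs /= cats0 -[LHS]cats0 twos.
case: s => [|i1 [|i2 s]] //=; rewrite ?mulnS // => -[] sz.
have {}sz : size s = (2 * n)%N by lia.
have -> : Zargs n.+1 [:: i0, i1, i2 & s] =
    nseq i0 2%N ++ (3%N :: nseq i1 2%N) ++ 1%N :: Zargs n (i2 :: s).
  rewrite /Zargs /= -!catA /=; congr (_ ++ 3%N :: (_ ++ 1%N :: (_ ++ _))).
  rewrite (iotaDl 1 0 n) -map_comp; congr flatten.
  by apply: eq_map => i; rewrite /comp add1n mulnS add2n.
have {}IH : mzv_word (Zargs n (i2 :: s)) = comp_word (i2 :: s) by rewrite IH //= sz.
move: (Zargs _ _) IH => Z IH.
rewrite mzv_cat twos /stay /= sz mul2n odd_double /=; congr iter.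
rewrite -[3%N :: _]cat1s -[1%N :: _]cat1s !mzv_cat twos IH /=.
rewrite /jump /stay /= sz mul2n odd_double /=.
set u := iter i2 _ _; congr [:: la, la & _].
by elim: i1 => //= i <-.
Qed.

(** * From lists of words to noncommutative polynomials *)

Lemma mcoeff_poly_of_word (u w : word) : mcoeff w (poly_of_word u) = (u == w)%:R.
Proof. by rewrite unlock mcoeffU. Qed.

Lemma msupp_poly_of_word (u : word) : msupp (poly_of_word u) = [fset u]%fset.
Proof. by rewrite unlock msuppU oner_eq0. Qed.

Lemma poly_of_wordM (u v : seq letter) :
  poly_of_word (FMonom u) * poly_of_word (FMonom v) = poly_of_word (FMonom (u ++ v)).
Proof.
rewrite unlock malgM_def fgmulUU mulr1; congr mkmalgU.
by rewrite /mmul /mul /= fmmulE.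
Qed.

Lemma shuffle_wordE (u v : seq letter) :
  shuffle_word u v = \sum_(w <- shuf u v) poly_of_word (FMonom w).
Proof.
have XlM c (s : seq (seq letter)) :
    Xl c * \sum_(w <- s) poly_of_word (FMonom w) =
    \sum_(w <- map (cons c) s) poly_of_word (FMonom w).
  by rewrite mulr_sumr big_map; apply: eq_bigr => w _; rewrite poly_of_wordM.
elim: u v => [|c u IHu] v; first by rewrite /= big_seq1.
elim: v => [|d v IHv]; first by rewrite /= big_seq1.
rewrite shuf_cons big_cat /= -!XlM -IHu.
by congr (_ + _ * _); rewrite -IHv.
Qed.

Lemma Xab_exp n : (Xl la * Xl lb) ^+ n = poly_of_word (FMonom (abn n)).
Proof.
elim: n => [|n IH].
  by rewrite expr0 unlock; congr mkmalgU; exact: fmoneE.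
by rewrite exprS IH /Xl !poly_of_wordM.
Qed.

Lemma shuffle_abn n p : shuffle ((Xl la * Xl lb) ^+ n) ((Xl la * Xl lb) ^+ p) =
  \sum_(w <- shuf (abn n) (abn p)) poly_of_word (FMonom w).
Proof.
rewrite !Xab_exp /shuffle !msupp_poly_of_word !big_seq_fset1.
by rewrite !mcoeff_poly_of_word !eqxx mulr1 scale1r shuffle_wordE.
Qed.

(** In the expansion of the shuffle by number of jumps, the count of aa singles out the term with 2n
    jumps, whose multiplicity is positive. *)
Lemma mem_S_words m n (w : word) : (2 * n <= m)%N ->
  (w \in S_words m n) = ((w : seq letter) \in paths m (2 * n)).
Proof.
move=> nm; rewrite !inE /= -mcoeff_neq0 shuffle_abn.
have := @shuf_expansionP _ n (m - n) n.+1 (fun w => poly_of_word (FMonom w)) (ltnSn n).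
rewrite /shufsum subnKC; last by lia.
move=> ->; rewrite raddf_sum /=.
have coefE j : mcoeff w (pathsum m (2 * j) (fun w => poly_of_word (FMonom w)) *+
     (4 ^ j * shufmul n (m - n) j)) =
     ((w : seq letter) \in paths m (2 * j))%:R *+ (4 ^ j * shufmul n (m - n) j).
  rewrite mcoeffMn; congr (_ *+ _); rewrite /pathsum raddf_sum /=.
  under eq_bigr do rewrite mcoeff_poly_of_word.
  have -> : \sum_(u <- paths m (2 * j)) (FMonom u == w)%:R =
            \sum_(u <- paths m (2 * j)) (u == w :> seq letter)%:R :> rat.
    by apply: eq_bigr => u _; rewrite -val_eqE.
  have [wP|wP] := boolP (_ \in _).
    rewrite (bigD1_seq _ wP (paths_uniq _ _)) /= eqxx big1 ?addr0 // => u.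
    by move=> /negbTE ->.
  rewrite big1_seq // => u /= uP; case: eqP => // uw.
  by move: uP wP; rewrite uw => ->.
under eq_bigr do rewrite coefE.
apply/andP/idP => [[+ /eqP aw]|wP].
  apply: contraNT => wP; rewrite big1 // => j _.
  have [wj|_] := boolP ((w : seq letter) \in paths m (2 * j)); last by rewrite mul0rn.
  have jn : j = n :> nat by rewrite -[RHS]aw (paths_count_aa wj) mul2n doubleK.
  by rewrite jn (negbTE wP) in wj.
have aw := paths_count_aa wP; rewrite mul2n doubleK in aw; split; last by rewrite aw.
(* The last term, j = n, has multiplicity 4^n C(m-2n, 0) > 0, and the others are nonnegative. *)
rewrite big_ord_recr /= wP gt_eqF // ltr_wpDl //.
  by apply: sumr_ge0 => j _; rewrite mulrn_wge0.
by rewrite pmulrn_rgt0 // muln_gt0 expn_gt0 /= shufmulE // ?subnn ?bin0; lia.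
Qed.

Lemma integral_T_poly (R : realType) (form : letter -> R -> R) m n : (2 * n <= m)%N ->
  integral_ncpoly form (T_poly m n) =
  (\sum_(w <- paths m (2 * n)) iterated_integral (map form w))%E.
Proof.
move=> nm; rewrite /integral_ncpoly.
have TE w : mcoeff w (T_poly m n) = (w \in S_words m n)%:R.
  rewrite /T_poly raddf_sum /=; under eq_bigr do rewrite mcoeff_poly_of_word.
  have [wS|wS] := boolP (_ \in _).
    rewrite (bigD1_seq _ wS (fset_uniq _)) /= eqxx big1 ?addr0 // => u.
    by move=> /negbTE ->.
  rewrite big1_seq // => u /= uS; case: eqP => // uw.
  by move: uS wS; rewrite uw => ->.
have -> : msupp (T_poly m n) = S_words m n.
  apply/fsetP => w; rewrite -mcoeff_neq0 TE.
  by case: (w \in _); rewrite ?oner_eq0 ?eqxx.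
rewrite big_seq; under eq_bigr => w wS do rewrite TE wS rmorph1 mul1e.
rewrite -big_seq.
rewrite -(big_map (fun w : word => w : seq letter) xpredT
  (fun w => iterated_integral (map form w))).
apply: perm_big; apply: uniq_perm.
- by rewrite map_inj_uniq ?fset_uniq // => -[u] [v] /= ->.
- exact: paths_uniq.
move=> w; apply/mapP/idP => [[u + ->]|wP]; first by rewrite mem_S_words.
by exists (FMonom w); rewrite // mem_S_words.
Qed.

Lemma sum_compositions (R : realType) m n : (2 * n <= m)%N ->
  (\sum_(s \in compositions (2 * n).+1 (m - 2 * n)) Zval R s)%E =
  (\sum_(s <- comps m (2 * n)) mzv R (Zargs n s))%E.
Proof.
move=> nm; pose r : seq ((2 * n).+1.-tuple nat) := pmap insub (comps m (2 * n)).
have rE : map val r = comps m (2 * n).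
  rewrite /r -[RHS]filter_predT /= pmap_filter; last exact: insubK.
  apply: eq_in_filter => s; rewrite mem_comps => /andP[/eqP sz _].
  by rewrite /= insubT ?sz ?eqxx.
have -> : compositions (2 * n).+1 (m - 2 * n) = [set` r].
  apply/seteqP; split => s /=; rewrite /compositions /= -(mem_map val_inj) rE;
    rewrite mem_comps size_tuple eqxx /= sumnE big_tuple.
    by move=> ->; rewrite subnK.
  by move=> /eqP <-; rewrite addnK.
rewrite -fsbig_seq; last by rewrite -(map_inj_uniq val_inj) rE comps_uniq.
by rewrite -rE big_map.
Qed.

(** * Power series coefficients of words *)

Section Coefficients.
Context {R : numFieldType}.
Implicit Types (f g : nat -> R) (u v w : seq letter).

(* The coefficient of x^N in the power series of the iterated integral of w
   from 0 to x. *)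
Fixpoint cw w (N : nat) : R :=
  match w with
  | [::] => (N == 0)%:R
  | la :: w' => cw w' N / N%:R
  | lb :: w' => (\sum_(k < N) cw w' k) / N%:R
  end.

Lemma cw_ge0 w N : 0 <= cw w N.
Proof.
elim: w N => [|[] w IH] N /=; first by case: (N == 0).
  by rewrite divr_ge0.
by rewrite divr_ge0 ?sumr_ge0.
Qed.

Lemma cw_cons0 c w : cw (c :: w) 0 = 0.
Proof. by case: c; rewrite /= invr0 mulr0. Qed.

Definition conv f g (N : nat) : R := \sum_(i < N.+1) f i * g (N - i)%N.

Lemma conv0f g N : conv (cw [::]) g N = g N.
Proof.
rewrite /conv big_ord_recl /= mul1r subn0 big1 ?addr0 // => i _.
by rewrite mul0r.
Qed.

Lemma convC f g N : conv f g N = conv g f N.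
Proof.
rewrite /conv (reindex_inj rev_ord_inj) /=; apply: eq_bigr => i _.
by rewrite subSS mulrC subKn // -ltnS.
Qed.

Lemma conv_cumul f g N :
  conv (fun n => \sum_(k < n) f k) g N = \sum_(M < N) conv f g M.
Proof.
elim: N => [|N IH]; first by rewrite /conv big_ord_recl !big_ord0 mul0r addr0.
rewrite big_ord_recr /= -IH /conv big_ord_recl big_ord0 mul0r add0r -big_split.
by apply: eq_bigr => i _; rewrite lift0 big_ord_recr /= mulrDl subSS.
Qed.

Lemma conv_leibniz f g N : N%:R * conv f g N =
  conv (fun i => i%:R * f i) g N + conv f (fun i => i%:R * g i) N.
Proof.
rewrite /conv mulr_sumr -big_split /=; apply: eq_bigr => i _.
rewrite [f i * (_ * _)]mulrCA -[i%:R * _ * _]mulrA -mulrDl -natrD subnKC //.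
by rewrite -ltnS.
Qed.

(** Multiplication of a power series by x times the density of the form: by 1 for a, by x/(1-x) for
    b. *)
Definition form_mul (c : letter) f (N : nat) : R :=
  if c is la then f N else \sum_(k < N) f k.

Lemma form_mul_sum c (s : seq (seq letter)) N :
  form_mul c (fun n => \sum_(w <- s) cw w n) N = \sum_(w <- s) form_mul c (cw w) N.
Proof. by case: c => //=; rewrite exchange_big. Qed.

Lemma eq_form_mul c f g N : f =1 g -> form_mul c f N = form_mul c g N.
Proof. by case: c => /= fg; [exact: fg | apply: eq_bigr]. Qed.

Lemma conv_form_mul c f g N : conv (form_mul c f) g N = form_mul c (conv f g) N.
Proof. by case: c => //=; exact: conv_cumul. Qed.

Lemma cwS c w N : N.+1%:R * cw (c :: w) N.+1 = form_mul c (cw w) N.+1.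
Proof. by case: c; rewrite /= mulrC divfK ?pnatr_eq0. Qed.

(** At N = 0 the condition on the last letter rules out the word a, whose integral diverges at 0. *)
Lemma cw_form_mul c w N : last lb (c :: w) = lb ->
  N%:R * cw (c :: w) N = form_mul c (cw w) N.
Proof.
case: N => [|N] wb; last exact: cwS.
rewrite mul0r; case: c wb => /=; last by rewrite big_ord0.
by case: w => // d w _; rewrite cw_cons0.
Qed.

(* Leibniz' rule for x d/dx. *)
Lemma conv_cw u v N : last lb u = lb -> last lb v = lb ->
  conv (cw u) (cw v) N = \sum_(w <- shuf u v) cw w N.
Proof.
elim: u v N => [|c u IHu] v N ub vb; first by rewrite conv0f big_seq1.
elim: v N vb => [|d v IHv] N vb; first by rewrite convC conv0f shufs0 big_seq1.
rewrite shuf_cons big_cat !big_map.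
case: N => [|N].
  have -> : conv (cw (c :: u)) (cw (d :: v)) 0 = cw (c :: u) 0 * cw (d :: v) 0.
    by rewrite /conv big_ord1.
  have z e (s : seq (seq letter)) : \sum_(w <- s) cw (e :: w) 0 = 0 :> R.
    by rewrite big1 // => w _; rewrite cw_cons0.
  by rewrite cw_cons0 mul0r !z [RHS]addr0.
have ub' : last lb u = lb by case: u ub {IHu IHv}.
have vb' : last lb v = lb by case: v vb {IHv}.
have N0 : N.+1%:R != 0 :> R by rewrite pnatr_eq0.
(* Multiplying by the index applies x d/dx. Each half of Leibniz' rule then strips the first letter
   of one factor, as the shuffle recursion does. *)
apply: (mulfI N0); rewrite conv_leibniz mulrDr !mulr_sumr.
under [in RHS]eq_bigr do rewrite cwS.
under [X in _ = _ + X]eq_bigr do rewrite cwS.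
rewrite -!form_mul_sum; congr (_ + _).
  rewrite -(eq_form_mul _ _ (fun n => IHu (d :: v) n ub' vb)) -conv_form_mul.
  by apply: eq_bigr => i _; rewrite cw_form_mul.
rewrite -(eq_form_mul _ _ (fun n => IHv n vb')).
rewrite (eq_form_mul _ _ (convC _ _)) -conv_form_mul convC.
by apply: eq_bigr => i _; rewrite cw_form_mul.
Qed.

Lemma last_abn n : last lb (abn n) = lb.
Proof. by elim: n. Qed.

Lemma conv_abn n p N : conv (cw (abn n)) (cw (abn p)) N =
  \sum_(j < n.+1) (\sum_(w <- paths (n + p) (2 * j)) cw w N) *+ (4 ^ j * shufmul n p j).
Proof.
rewrite conv_cw ?last_abn //.
exact: (@shuf_expansionP _ n p n.+1 (cw^~ N)).
Qed.

(** Thus [cw] at N is the part of the nested sum with largest index n_1 = N. *)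
Lemma cw_mzv_word i s N : (0 < i)%N ->
  cw (mzv_word (i :: s)) N = N%:R ^- i * \sum_(k < N) cw (mzv_word s) k.
Proof.
case: i => // i _; rewrite /mzv_word /= -/(mzv_word s).
elim: i => [|i IH]; first by rewrite expr1 mulrC.
by rewrite [LHS]/= IH [in RHS]exprS invfM [LHS]mulrC mulrA.
Qed.

(** Both sides are the sum for zeta({2}^n) over indices at most N; separating the largest index N+1
    gives the recursion [esymRS]. *)
Lemma sum_cw_abn n N :
  \sum_(k < N.+1) cw (abn n) k = esymR N (fun k => k.+1%:R ^- 2) n :> R.
Proof.
elim: n N => [|n IH] N.
  by rewrite esymRS0 big_ord_recl big1 ?addr0 // => i _.
elim: N => [|N IHN]; first by rewrite esymR0 big_ord_recl big_ord0 cw_cons0 addr0.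
rewrite big_ord_recr IHN esymRS -IH [cw _ _]/=; congr (_ + _).
by rewrite expr2 invfM [RHS]mulrC mulrA.
Qed.

End Coefficients.

(** * Summation of the power series coefficients *)

Section Series.
Context {R : realType}.
Implicit Types (f g : nat -> R) (w : seq letter) (s : seq nat).

Definition wval w : \bar R := (\sum_(N <oo) (cw w N)%:E)%E.

Lemma esum_II (n : nat) (a : nat -> \bar R) : (forall i, 0 <= a i)%E ->
  (\esum_(i in `I_n) a i = \sum_(i < n) a i)%E.
Proof. by move=> a0; rewrite esum_fset ?fsbig_ord //; exact: finite_II. Qed.

(** Cauchy product by Tonelli: both sides sum f_i g_j over all pairs, on the left along
    antidiagonals. Only the sum of [g] is assumed finite; that of [f] may be infinite. *)
Lemma nneseries_conv f g (c : R) : (forall i, 0 <= f i) -> (forall i, 0 <= g i) ->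
  (\sum_(j <oo) (g j)%:E = c%:E)%E ->
  (\sum_(N <oo) (conv f g N)%:E = (\sum_(i <oo) (f i)%:E) * c%:E)%E.
Proof.
move=> f0 g0 gc; pose a i j : \bar R := (f i * g j)%:E.
have a0 i j : (0 <= a i j)%E by rewrite lee_fin mulr_ge0.
have -> : ((\sum_(i <oo) (f i)%:E) * c%:E = \sum_(i <oo) \sum_(j <oo) a i j)%E.
  rewrite muleC -nneseriesZl; last by move=> i _; rewrite lee_fin.
  apply: eq_eseriesr => i _; rewrite muleC -gc -nneseriesZl //.
  by move=> j _; rewrite lee_fin.
rewrite nneseries_esumT; last first.
  by move=> n; rewrite lee_fin; apply: sumr_ge0 => i _; rewrite mulr_ge0.
rewrite nneseries_esumT; last by move=> i; exact: nneseries_ge0.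
under [RHS]eq_esum do rewrite nneseries_esumT //.
under eq_esum do rewrite -sumEFin -(@esum_II _ (fun i => a i (_ - i)%N)) //.
rewrite !esum_esum //.
rewrite [RHS](reindex_esum ([set: nat] `*`` (fun N => `I_N.+1)) _
  (fun k => (k.2, (k.1 - k.2)%N))) //.
split=> [[N i]//|[N i] [M j]|[i j] _] /=.
  rewrite !inE /= => -[_ iN] [_ jM] [ij]; subst j => MN; congr pair.
  by rewrite -(subnK (iN : (i <= N)%N)) MN subnK.
by exists ((i + j)%N, i); rewrite /= ?addKn //; split => //=; rewrite ltnS leq_addr.
Qed.

Lemma wval_abn n : wval (abn n) = (pi ^+ n.*2 / (n.*2.+1)`!%:R)%:E.
Proof.
apply/cvg_lim => //; rewrite -cvg_shiftS /=.
under eq_cvg do rewrite sumEFin big_mkord sum_cw_abn.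
by apply/cvg_EFin; [exact: nearW|exact: cvg_esymR_invn2].
Qed.
End Series.

(** * Multiple zeta values *)

Section MultipleZeta.
Context {R : realType}.
Implicit Types (s : seq nat).

Definition mzv_term s (n : (size s).-tuple nat) : R :=
  \prod_(j < size s) (tnth n j)%:R ^- tnth (in_tuple s) j.

Lemma mzv_term_ge0 s n : 0 <= @mzv_term s n.
Proof. by apply: prodr_ge0 => j _; rewrite invr_ge0 exprn_ge0. Qed.

Lemma mzv_term_cons i s k (n : (size s).-tuple nat) :
  @mzv_term (i :: s) (cons_tuple k n) = k%:R ^- i * mzv_term n.
Proof.
rewrite /mzv_term /= big_ord_recl; congr (_ * _).
apply: eq_bigr => j _; congr (_%:R ^- _); first by rewrite tnthS.
by rewrite !(tnth_nth 0%N).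
Qed.

(** Restricting the head to [B] bounds the tail of a tuple by its head k, as [I_k], and gives the
    full index set of [mzv] when [B] is everything. *)
Definition decr_below (B : set nat) s : set ((size s).-tuple nat) :=
  [set n : (size s).-tuple nat | (sorted gtn n /\ all (fun x => 0 < x)%N n) /\
           (if tval n is k :: _ then B k else True)].
Arguments decr_below : clear implicits.

Lemma esum_decr_cons (c : R) (B : set nat) i s : 0 <= c ->
  (\esum_(n in decr_below B (i :: s)) (c * mzv_term n)%:E =
   \esum_(k in [set k | (0 < k)%N] `&` B)
     \esum_(n in decr_below `I_k s) (c * k%:R ^- i * mzv_term n)%:E)%E.
Proof.
move=> c0; rewrite esum_esum; last first.
  by move=> k n _ _; rewrite lee_fin !mulr_ge0 ?mzv_term_ge0 ?invr_ge0 ?exprn_ge0.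
under [RHS]eq_esum do rewrite -mulrA -mzv_term_cons.
apply: (reindex_esum _ _ (fun p => cons_tuple p.1 p.2 : (size (i :: s)).-tuple nat)).
split=> [[k [n szn]]|[k n] [l n'] _ _ /= kn|[[//|k n] szn]] /=.
- move=> -[[k0 Bk] [[ns n0] nk]]; split => //=; rewrite k0 n0; split => //.
  by case: n szn ns n0 nk => //= l n _ -> _ ->.
- have [-> nn'] : k = l /\ n = n' :> seq nat by move: kn => /(congr1 val)[].
  by congr pair; exact: val_inj.
move=> -[[/= ns /andP[k0 n0]] Bk].
exists (k, @Tuple (size s) nat n szn); last exact: val_inj.
do ?split => //=; first exact: path_sorted ns.
by case: n ns {szn n0} => //= l n /andP[].
Qed.

Lemma esum_pos_cw (B : set nat) (w : seq letter) (c : R) i : (0 < i)%N ->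
  (\esum_(k in [set k | (0 < k)%N] `&` B) (c * k%:R ^- i * \sum_(j < k) cw w j)%:E =
   \esum_(k in B) (c * (k%:R ^- i * \sum_(j < k) cw w j))%:E)%E.
Proof.
move=> i0; rewrite esum_mkcondl; apply: eq_esum => -[|k] _.
  by rewrite memNset // big_ord0 !mulr0.
by rewrite mem_set // mulrA.
Qed.

(** The largest index is summed last. For the empty string, 0 < N puts the single nonzero
    coefficient in range. *)
Lemma esum_decr_below s (c : R) N : all (leq 1) s -> 0 <= c -> (0 < N)%N ->
  (\esum_(n in decr_below `I_N s) (c * mzv_term n)%:E =
   (c * \sum_(k < N) cw (mzv_word s) k)%:E)%E.
Proof.
elim: s c N => [|i s IH] c N /= s0 c0 N0.
  have -> : decr_below `I_N [::] = [set [tuple]].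
    by apply/seteqP; split => n /= _; rewrite ?tuple0 //; split.
  rewrite esum_set1 /mzv_term /= big_ord0 ?lee_fin ?mulr1 //.
  case: N N0 => // N _; rewrite big_ord_recl big1 ?addr0 ?mulr1 // => k _.
have /andP[i0 {}s0] := s0.
rewrite esum_decr_cons //.
have cki k : 0 <= c * k%:R ^- i by rewrite mulr_ge0 ?invr_ge0 ?exprn_ge0.
under eq_esum => k -[k0 _] do rewrite IH //.
rewrite esum_pos_cw //; under eq_esum do rewrite -cw_mzv_word //.
rewrite esum_II; last by move=> k; rewrite lee_fin mulr_ge0 ?cw_ge0.
by rewrite sumEFin mulr_sumr.
Qed.

Lemma mzvE s : all (leq 1) s -> mzv R s = wval (mzv_word s).
Proof.
case: s => [|i s] s0.
  rewrite (_ : mzv_word [::] = abn 0) // wval_abn /mzv /= divr1.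
  rewrite (_ : [set n | _] = [set [tuple]]) ?esum_set1 ?big_ord0 ?lee_fin //.
  by apply/seteqP; split => n /= _; rewrite ?tuple0.
have mzvE : mzv R (i :: s) =
    (\esum_(n in decr_below [set: nat] (i :: s)) (1 * mzv_term n)%:E)%E.
  rewrite /mzv; under [RHS]eq_esum do rewrite mul1r.
  congr (\esum_(n in _) _)%E; apply/seteqP; split => n /=; last by case.
  by split => //; case: (tval n).
move: s0 => /= /andP[i0 s0]; rewrite mzvE esum_decr_cons //.
under eq_esum => k -[k0 _] do
  rewrite esum_decr_below ?mulr_ge0 ?invr_ge0 ?exprn_ge0 //.
rewrite esum_pos_cw // /wval nneseries_esumT; last by move=> k; rewrite lee_fin cw_ge0.
by apply: eq_esum => k _; rewrite mul1r cw_mzv_word.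
Qed.
End MultipleZeta.

(** * Iterated integrals *)

Section IteratedIntegrals.
Context {R : realType}.
Implicit Types (c : nat -> R) (w : seq letter) (x t : R).
Let mu := @lebesgue_measure R.

Definition pser c x : \bar R := (\sum_(N <oo) (c N * x ^+ N)%:E)%E.

Lemma pser_ge0 c x : (forall N, 0 <= c N) -> 0 <= x -> (0 <= pser c x)%E.
Proof.
by move=> c0 x0; apply: nneseries_ge0 => N _ _; rewrite lee_fin mulr_ge0 ?exprn_ge0.
Qed.

Lemma measurable_pser c x : (forall N, 0 <= c N) ->
  measurable_fun `]0, x[ (pser c).
Proof.
move=> c0; apply: (@ge0_emeasurable_sum _ _ _ _ (fun N t => (c N * t ^+ N)%:E) xpredT).
  move=> N t /=; rewrite in_itv /= => /andP[/ltW t0 _] _.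
  by rewrite lee_fin mulr_ge0 ?exprn_ge0.
move=> N _; apply/measurable_EFinP; exact: measurable_funM.
Qed.

Lemma nneseries_shift (f : nat -> \bar R) : f 0%N = 0%E -> (forall N, 0 <= f N)%E ->
  (\sum_(N <oo) f N = \sum_(N <oo) f N.+1)%E.
Proof.
move=> f00 f0; apply/cvg_lim => //; rewrite -cvg_shiftS /=.
under eq_cvg do rewrite big_nat_recl // f00 add0e.
exact: is_cvg_nneseries.
Qed.

Lemma integral_exprn x n : 0 < x ->
  (\int[mu]_(t in `]0%R, x[) (t ^+ n)%:E = (x ^+ n.+1 / n.+1%:R)%:E)%E.
Proof.
move=> x0.
rewrite -(@integral_itv_bndoo _ 0 x (fun t => (t ^+ n)%:E) true false); last first.
  by apply/measurable_EFinP; exact: exprn_measurable.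
have cF t : {for t, continuous (fun t : R => t ^+ n.+1 / n.+1%:R)}.
  by apply: cvgM; [exact: exprn_continuous | exact: cvg_cst].
rewrite (@continuous_FTC2 _ (fun t => t ^+ n) (fun t => t ^+ n.+1 / n.+1%:R) 0 x x0).
- by rewrite expr0n mul0r sube0.
- by apply: continuous_subspaceT => t; exact: exprn_continuous.
- split; first by move=> t _; apply: derivableM => //; exact: exprn_derivable.
  + by apply: cvg_at_right_filter; exact: cF.
  + by apply: cvg_at_left_filter; exact: cF.
- move=> t _; rewrite derive1Mr ?exp_derive1; last exact: exprn_derivable.
  by rewrite /= mulrC mulrA mulVf ?pnatr_eq0 // mul1r.
Qed.

Lemma eseries_geometric t : 0 <= t < 1 ->
  (\sum_(N <oo) (t ^+ N)%:E = (1 - t)^-1%:E)%E.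
Proof.
move=> /andP[t0 t1]; apply/cvg_lim => //.
under eq_cvg do rewrite sumEFin.
apply/cvg_EFin; first exact: nearW.
have := @cvg_geometric_series R 1 t; rewrite ger0_norm // mul1r => /(_ t1).
by rewrite -exprn_geometric.
Qed.

(** The factor 1/t shifts the coefficients, and 1/(1-t) gives a Cauchy product with the geometric
    series. Either way the result is the termwise derivative of the series of [k :: w]. *)
Lemma form_pser k w t : last lb (k :: w) = lb -> 0 < t < 1 ->
  ((form01 k t)%:E * pser (cw w) t =
   pser (fun N => (N.+1%:R * cw (k :: w) N.+1)%R) t)%E.
Proof.
move=> wb /andP[t0 t1]; have cwt N : 0 <= cw w N * t ^+ N.
  by rewrite mulr_ge0 ?cw_ge0 // exprn_ge0 // ltW.
case: k wb => wb; rewrite [form01 _ _]/=.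
  case: w wb cwt => // d w _ cwt.
  rewrite /pser nneseries_shift; last 2 first.
  - by rewrite cw_cons0 mul0r.
  - by move=> N; exact: cwt.
  rewrite -nneseriesZl; last by move=> N _; exact: cwt.
  apply: eq_eseriesr => N _; rewrite -EFinM; congr (_%:E).
  by rewrite cwS mulrCA exprS mulKf ?gt_eqF.
rewrite muleC -(@nneseries_conv _ _ (fun N => t ^+ N)) //.
- apply: eq_eseriesr => N _; congr (_%:E).
  rewrite cwS /conv mulr_suml; apply: eq_bigr => i _.
  by rewrite -mulrA -exprD subnKC // -ltnS.
- by move=> N; rewrite exprn_ge0 // ltW.
- by rewrite eseries_geometric // ltW.
Qed.

(** All terms are nonnegative, so termwise integration is valid up to and including x = 1. *)
Lemma integral_pser k w x : last lb (k :: w) = lb -> 0 < x <= 1 ->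
  (\int[mu]_(t in `]0%R, x[) ((form01 k t)%:E * pser (cw w) t) =
   pser (cw (k :: w)) x)%E.
Proof.
move=> wb /andP[x0 x1].
pose d N : R := N.+1%:R * cw (k :: w) N.+1.
have d0 N : 0 <= d N by rewrite mulr_ge0 ?cw_ge0.
transitivity (\int[mu]_(t in `]0%R, x[) pser d t)%E.
  apply: eq_integral => t; rewrite inE /= in_itv /= => /andP[t0 tx].
  by rewrite form_pser // t0 (lt_le_trans tx).
rewrite /pser integral_nneseries //; last 2 first.
- move=> N; apply/measurable_EFinP; exact: measurable_funM.
- move=> N t /=; rewrite in_itv /= => /andP[/ltW t0 _].
  by rewrite lee_fin mulr_ge0 ?exprn_ge0.
rewrite [RHS]nneseries_shift; last 2 first.
- by rewrite cw_cons0 mul0r.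
- by move=> N; rewrite lee_fin mulr_ge0 ?cw_ge0 // exprn_ge0 // ltW.
apply: eq_eseriesr => N _; under eq_integral do rewrite EFinM.
rewrite ge0_integralZl_EFin //; last 2 first.
- by move=> t /=; rewrite in_itv /= => /andP[/ltW t0 _]; rewrite lee_fin exprn_ge0.
- by apply/measurable_EFinP; exact: exprn_measurable.
rewrite integral_exprn // -EFinM; congr (_%:E).
rewrite /d; move: (cw _ _) (x ^+ _) => A B.
by rewrite [N.+1%:R * A]mulrC -mulrA [B / _]mulrC mulVKf ?pnatr_eq0.
Qed.

Lemma pser_nil x : pser (cw [::]) x = 1%E.
Proof.
have -> : pser (cw [::]) x = wval [::].
  by apply: eq_eseriesr => -[|N] _; rewrite /= ?mulr1 ?mul0r.
by rewrite -[LHS]/(wval (abn 0)) wval_abn mul1r invr1.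
Qed.

(** Generalised for induction: [c] collects the densities at the outer variables, and [x] is the
    variable bounding the next one. *)
Lemma integral_Rn_form01 w (c x : R) (fs := map (@form01 R) w) :
  last lb w = lb -> 0 <= c -> x <= 1 ->
  integral_Rn (size fs) (fun ts =>
    (c * (if sorted >%R (x :: rcons ts 0)
          then \prod_(j < size fs) (tnth (in_tuple fs) j) (nth 0 ts j)
          else 0))%:E) =
  (if (0 < x)%R then c%:E * pser (cw w) x else 0)%E.
Proof.
rewrite {}/fs; elim: w c x => [|k w IH] c x wb c0 x1.
  rewrite /= andbT pser_nil mule1 big_ord0.
  by case: ifP => _; rewrite ?mulr1 ?mulr0.
have wb' : last lb w = lb by case: w wb {IH}.
pose g t := (c%:E * ((form01 k t)%:E * pser (cw w) t))%E.
transitivity (\int[mu]_t ((g \_ `]0%R, x[) t))%E.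
  rewrite /=; apply: eq_integral => t _.
  (* The constraint 0 < t < x goes into the constant, since the induction hypothesis, applied with
     bound t, does not see x. *)
  pose c' := if 0 < t < x then c * form01 k t else 0.
  have c'0 : 0 <= c'.
    rewrite /c'; case: ifPn => // /andP[t0 tx].
    rewrite mulr_ge0 //; case: (k) => /=; rewrite invr_ge0 ?(ltW t0) // subr_ge0.
    by rewrite ltW // (lt_le_trans tx).
  have -> : (g \_ `]0, x[) t = (if (0 < t)%R then c'%:E * pser (cw w) t else 0)%E.
    rewrite patchE mem_setE in_itv /= /c'; case: (ltP 0 t) => //= t0.
    by case: ifP => _; rewrite ?mul0e // /g EFinM muleA.
  have sorted_pos ts : sorted >%R (t :: rcons ts 0) -> 0 < t.
    move=> /(order_path_min (fun u v z (vu : u < v) (uz : z < u) => lt_trans uz vu)).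
    move=> /allP; apply.
    by rewrite mem_rcons inE eqxx.
  (* The induction hypothesis needs a bound at most 1; for t > 1 the constant [c'] is 0 because x <=
     1. *)
  pose u : R := Num.min t 1.
  have -> : (if (0 < t)%R then c'%:E * pser (cw w) t else 0)%E =
      (if (0 < u)%R then c'%:E * pser (cw w) u else 0)%E.
    rewrite /c' /u; have [//|t1] := leP t 1.
    rewrite (lt_trans ltr01 t1) [t < x]ltNge (le_trans x1 (ltW t1)) /=.
    by rewrite !mul0e if_same.
  rewrite -(IH _ u) ?ge_min ?lexx ?orbT //.
  congr integral_Rn; apply/funext => ts; congr (_%:E).
  rewrite /c' /u /=; have [tx|tx] := ltP t x; last by rewrite andbF !mul0r mulr0.
  rewrite (elimT min_idPl (ltW (lt_le_trans tx x1))) andbT /=.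
  case: ifPn => [ts0|_]; last by rewrite !mulr0.
  rewrite (sorted_pos ts) // -mulrA; congr (_ * _).
  rewrite big_ord_recl; congr (_ * _); apply: eq_bigr => j _.
  by rewrite !(tnth_nth (form01 k)).
rewrite -integral_mkcond; have [x0|x0] := ltP 0 x; last first.
  by rewrite set_itv_ge ?integral_set0 // bnd_simp -leNgt.
rewrite ge0_integralZl_EFin //.
- by rewrite integral_pser ?x0.
- move=> t /=; rewrite in_itv /= => /andP[t0 tx].
  rewrite mule_ge0 ?pser_ge0 ?(ltW t0) //; last by move=> N; exact: cw_ge0.
  rewrite lee_fin; case: (k) => /=; rewrite invr_ge0 ?(ltW t0) // subr_ge0.
  by rewrite ltW // (lt_le_trans tx).
- apply: emeasurable_funM; last by apply: measurable_pser => N; exact: cw_ge0.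
  apply/measurable_EFinP.
  apply: open_continuous_measurable_fun; first exact: interval_open.
  move=> t; rewrite inE /= in_itv /= => /andP[t0 tx].
  case: (k); first by apply: inv_continuous; rewrite gt_eqF.
  apply: (@continuous_comp _ _ _ (fun t : R => 1 - t) (@GRing.inv R)); last first.
    by apply: inv_continuous; rewrite gt_eqF // subr_gt0 (lt_le_trans tx).
  by apply: cvgB; [exact: cvg_cst | exact: cvg_id].
Qed.

Lemma iterated_integral_form01 w : last lb w = lb ->
  iterated_integral (map (@form01 R) w) = wval w.
Proof.
move=> wb; have := @integral_Rn_form01 w 1 1 wb ler01 (lexx 1).
rewrite ltr01 mul1e /iterated_integral.
have -> : pser (cw w) 1 = wval w.
  by apply: eq_eseriesr => N _; rewrite expr1n mulr1.
by move=> <-; congr integral_Rn; apply/funext => ts; rewrite mul1r.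
Qed.

End IteratedIntegrals.

(** * Evaluation *)

Section Evaluation.
Context {R : realType}.
Implicit Types (m n p : nat) (w : seq letter).

Lemma wval_ge0 w : (0 <= wval w :> \bar R)%E.
Proof. by apply: nneseries_ge0 => N _ _; rewrite lee_fin cw_ge0. Qed.

(** One row of the triangular system: the shuffle identity for coefficients, summed over N. *)
Lemma wval_abnM n p : (wval (abn n) * wval (abn p) =
  \sum_(j < n.+1) (4 ^ j * shufmul n p j)%N%:R%:E *
    \sum_(w <- paths (n + p) (2 * j)) wval w :> \bar R)%E.
Proof.
rewrite [X in (_ * X)%E]wval_abn.
rewrite -(@nneseries_conv R (cw (abn n)) (cw (abn p))); first last.
- exact: wval_abn.
- exact: cw_ge0.
- exact: cw_ge0.
transitivity (\sum_(N <oo) \sum_(j < n.+1) (4 ^ j * shufmul n p j)%N%:R%:E *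
    \sum_(w <- paths (n + p) (2 * j)) (cw w N)%:E : \bar R)%E.
  apply: eq_eseriesr => N _; rewrite conv_abn -sumEFin; apply: eq_bigr => j _.
  by rewrite sumEFin -EFinM mulr_natl.
rewrite nneseries_sum; last first.
  move=> j N _; rewrite mule_ge0 ?lee_fin //.
  by apply: sume_ge0 => w _; rewrite lee_fin cw_ge0.
apply: eq_bigr => j _; rewrite nneseriesZl; last first.
  by move=> N _; apply: sume_ge0 => w _; rewrite lee_fin cw_ge0.
by rewrite nneseries_sum // => w N _; rewrite lee_fin cw_ge0.
Qed.

Lemma size_shuf (u v : seq letter) : size (shuf u v) = 'C(size u + size v, size u).
Proof.
elim: u v => [|c u IHu] v; first by rewrite bin0.
elim: v => [|d v IHv]; first by rewrite addn0 binn.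
by rewrite shuf_cons size_cat !size_map IHu IHv /= [in RHS]addSn binS addnC addSnnS.
Qed.

Lemma size_abn n : size (abn n) = (2 * n)%N.
Proof. by elim: n => //= n ->; rewrite mulnS. Qed.

Lemma size_paths m k : size (paths m k) = 'C(m, k).
Proof.
elim: m k => [|m IH] [|k] //=; rewrite size_cat !size_map IH ?addn0 ?bin0 //.
by rewrite IH binS.
Qed.

(* Both sides count the words in the shuffle of b(ab)^n and b(ab)^p. *)
Lemma bin_shuf n p : 'C(2 * (n + p) + 2, 2 * n + 1)%:R =
  \sum_(j < n.+1) ('C((n + p) + 1, 2 * j + 1) * (2 * 4 ^ j * shufmul n p j))%N%:R :> R.
Proof.
have [_ /(_ n.+1 (fun=> 1) (ltnSn n))] := @shuf_expansions R n p.
have sum1 (T : Type) (s : seq T) : \sum_(x <- s) 1 = (size s)%:R :> R.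
  by rewrite big_const_seq count_predT iter_addr addr0.
rewrite /shufsum sum1 size_shuf /= !size_abn => E.
have -> : 'C(2 * (n + p) + 2, 2 * n + 1) = 'C((2 * n).+1 + (2 * p).+1, (2 * n).+1).
  by congr 'C(_, _); lia.
rewrite E; apply: eq_bigr => j _.
by rewrite /pathsum sum1 size_paths !addn1 natrM mulr_natr.
Qed.

(** Forward substitution: the row for n and m - n determines the nth unknown from the previous
    ones. *)
Lemma sum_paths_wval m n : (2 * n <= m)%N ->
  (\sum_(w <- paths m (2 * n)) wval w =
   (2 * pi ^+ (2 * m) / ((2 * m + 2)`!)%:R * 'C(m + 1, 2 * n + 1)%:R : R)%:E)%E.
Proof.
elim/ltn_ind: n => n IH nm.
pose v j : R := 2 * pi ^+ (2 * m) / ((2 * m + 2)`!)%:R * 'C(m + 1, 2 * j + 1)%:R.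
pose p := (m - n)%N; have npm : (n + p)%N = m by rewrite /p; lia.
have := wval_abnM n p; rewrite !wval_abn npm -EFinM big_ord_recr /=.
have -> : (\sum_(j < n) (4 ^ j * shufmul n p j)%N%:R%:E *
    \sum_(w <- paths m (2 * j)) wval w =
    (\sum_(j < n) (4 ^ j * shufmul n p j)%N%:R * v j)%:E)%E.
  rewrite -sumEFin; apply: eq_bigr => j _; rewrite (IH j (ltn_ord j)) //.
  by rewrite (leq_trans _ nm) // leq_mul2l ltnW.
(* The claimed values satisfy this row by [bin_shuf], as (2m+2)! = C(2m+2, 2n+1) (2n+1)! (2p+1)!. *)
have -> : pi ^+ n.*2 / (n.*2.+1)`!%:R * (pi ^+ p.*2 / (p.*2.+1)`!%:R) =
    \sum_(j < n) (4 ^ j * shufmul n p j)%N%:R * v j +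
    (4 ^ n * shufmul n p n)%N%:R * v n :> R.
  have := bin_shuf n p; rewrite npm => H.
  have -> : \sum_(j < n) (4 ^ j * shufmul n p j)%N%:R * v j +
      (4 ^ n * shufmul n p n)%N%:R * v n =
      pi ^+ (2 * m) / ((2 * m + 2)`!)%:R * 'C(2 * m + 2, 2 * n + 1)%:R :> R.
    rewrite H mulr_sumr big_ord_recr; congr (_ + _).
      by apply: eq_bigr => j _; rewrite /v !natrM; ring.
    by rewrite /v !natrM; ring.
  have E : (2 * m + 2)`! = ('C(2 * m + 2, 2 * n + 1) * (n.*2.+1`! * p.*2.+1`!))%N.
    have nm2 : (2 * n + 1 <= 2 * m + 2)%N by lia.
    rewrite -(bin_fact nm2); congr (_ * (_`! * _`!))%N; lia.
  have C0 : 'C(2 * m + 2, 2 * n + 1)%:R != 0 :> R.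
    by rewrite pnatr_eq0 -lt0n bin_gt0; lia.
  have n0 : (n.*2.+1)`!%:R != 0 :> R by rewrite pnatr_eq0 -lt0n fact_gt0.
  have p0 : (p.*2.+1)`!%:R != 0 :> R by rewrite pnatr_eq0 -lt0n fact_gt0.
  move: E C0 n0 p0; move: ((2 * m + 2)`!) ((n.*2.+1)`!) ((p.*2.+1)`!) 'C(_, _).
  move=> D A B C -> C0 A0 B0; rewrite !natrM -npm mulnDr exprD -!mul2n.
  by field; rewrite C0 A0 B0.
have k0 : (0 < 4 ^ n * shufmul n p n)%N.
  by rewrite muln_gt0 expn_gt0 /= shufmulE ?subnn ?bin0 // /p; lia.
(* The unknown is an extended real: nonnegativity excludes -oo, and +oo would contradict the finite
   product of zeta values. *)
have : (0 <= \sum_(w <- paths m (2 * n)) wval w :> \bar R)%E.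
  by apply: sume_ge0 => w _; exact: wval_ge0.
rewrite -/(v n); case: (\sum_(w <- _) _)%E => [r _| _|//].
  rewrite -EFinM -EFinD => -[/addrI/mulfI ->] //.
  by rewrite pnatr_eq0 -lt0n.
by rewrite gt0_muley ?lte_fin ?ltr0n.
Qed.

Lemma Zval0E m : @Zval R 0 [tuple m] = wval (abn m) :> \bar R.
Proof.
rewrite /Zval -[Zarg _]/(Zargs 0 [:: m]) mzvE.
  rewrite Zargs_word //=; congr wval.
  by elim: m => //= m ->.
Qed.

Lemma sum_comps_mzv m n :
  (\sum_(s <- comps m (2 * n)) mzv R (Zargs n s) =
   \sum_(w <- paths m (2 * n)) wval w)%E.
Proof.
rewrite -comp_word_comps big_map big_seq [RHS]big_seq; apply: eq_bigr => s.
rewrite mem_comps => /andP[/eqP sz _]; rewrite mzvE ?Zargs_word //.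
rewrite /Zargs all_cat all_nseq orbT /=; apply/allP => x /flattenP[t /mapP[i _ ->]].
rewrite inE => /orP[/eqP -> //|]; rewrite mem_cat inE !mem_nseq.
by move=> /or3P[/andP[_ /eqP ->]|/eqP ->|/andP[_ /eqP ->]].
Qed.

End Evaluation.

Theorem corollary5p1 (R : realType) (m n : nat) (hmn : (2 * n <= m)%N) :
  [/\ (\sum_(s \in compositions (2 * n).+1%N (m - 2 * n)%N) Zval R s)%E
        = integral_ncpoly (@form01 R) (T_poly m n),
      integral_ncpoly (@form01 R) (T_poly m n)
        = (@Zval R 0 [tuple m] / (2 * n + 1)%N%:R%:E * 'C(m, 2 * n)%:R%:E)%E
    & (@Zval R 0 [tuple m] / (2 * n + 1)%N%:R%:E * 'C(m, 2 * n)%:R%:E)%E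
        = (2 * pi ^+ (2 * m) / ((2 * m + 2)`!)%:R
             * 'C(m + 1, 2 * n + 1)%:R)%:E].
Proof.
have TE : integral_ncpoly (@form01 R) (T_poly m n) =
    (\sum_(w <- paths m (2 * n)) wval w)%E.
  rewrite integral_T_poly // big_seq [RHS]big_seq; apply: eq_bigr => w wP.
  by rewrite iterated_integral_form01 // (paths_last wP).
have ZE : (@Zval R 0 [tuple m] / (2 * n + 1)%N%:R%:E * 'C(m, 2 * n)%:R%:E)%E =
    (2 * pi ^+ (2 * m) / ((2 * m + 2)`!)%:R * 'C(m + 1, 2 * n + 1)%:R)%:E.
  rewrite Zval0E wval_abn inver pnatr_eq0 addn1 /= -!EFinM; congr (_%:E).
  (* Absorption of m+1 into the binomial coefficient, matched by the factor 2(m+1) of (2m+2)! over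
     (2m+1)!. *)
  have E : ((m + 1) * 'C(m, 2 * n) = (2 * n).+1 * 'C(m + 1, (2 * n).+1))%N.
    by rewrite addn1 mul_bin_diag.
  have F : (2 * m + 2)`! = (2 * (m + 1) * (m.*2.+1)`!)%N.
    by rewrite -!mul2n addn2 factS; congr (_ * _)%N; lia.
  have n0 : (2 * n).+1%:R != 0 :> R by rewrite pnatr_eq0.
  have m0 : (m + 1)%:R != 0 :> R by rewrite pnatr_eq0 addn1.
  have f0 : (m.*2.+1)`!%:R != 0 :> R by rewrite pnatr_eq0 -lt0n fact_gt0.
  rewrite F [(2 * m)%N]mul2n; move: E f0 n0 m0.
  move: (2 * n).+1 (m + 1)%N ((m.*2.+1)`!) 'C(m, _) 'C(m + 1, _) => a b c x y.
  move=> /(congr1 (fun k => k%:R : R)); rewrite !natrM => E c0 a0 b0.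
  apply: (mulfI b0); rewrite [LHS]mulrCA E.
  by field; rewrite a0 b0 c0.
split; first by rewrite sum_compositions // sum_comps_mzv TE.
  by rewrite TE sum_paths_wval // ZE.
exact: ZE.
Qed.
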